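(* Let $\mathcal A=(Q_n,\{0,1\},\delta,\lambda)\in\mathfrak F$, with $n\ge 1$, and let $(01)[\mathcal A]\in\mathfrak F'$ be the corresponding automaton. Then the group generated by the free monoid automorphism $(01)^*$ and the elements $(01)^*\mathcal A_q=(01)[\mathcal A]_q$, with $q\in Q_n$, is a free product of $n+4$ cyclic groups of order two, freely generated by $(01)^*$ and the $n+3$ states of $(01)[\mathcal A]$. In particular, the states of each member of $\mathfrak F'$ freely generate a free product of cyclic groups of order two.
   Context: A finite (Mealy) automaton is a $4$-tuple $\mathcal A=(Q,A,\delta,\lambda)$ with $Q$ a finite set of states, $A$ a finite alphabet, $\delta:Q\times A\to Q$ and $\lambda:Q\times A\to A$; write $q_x=\delta(q,x)$ and $q(x)=\lambda(q,x)$. Each state $q$ defines a length-preserving map $\mathcal A_q:A^*\to A^*$, $w\mapsto q(w)$, fixing the empty word and satisfying $q(xu)=q(x)\,q_x(u)$ for $x\in A$, $u\in A^*$. Over the alphabet $\{0,1\}$, write $q=\sigma(r,s)$ to mean $q(x)=\sigma(x)$ for $x\in\{0,1\}$, $q_0=r$, $q_1=s$; here $\sigma$ is a permutation of $\{0,1\}$ and $(01)$ denotes the transposition. The family $\mathfrak F$ consists of all automata over $\{0,1\}$ of the following form: for some odd integer $n\ge 1$, the state set is $Q_n=\{a,b,c,d_1,\dots,d_n\}$ ($n+3$ states), and $$a=(01)(c,b),\quad b=(01)(b,c),\quad c=\sigma_0(d_1,d_1),\quad d_i=\sigma_i(d_{i+1},d_{i+1})\ (1\le i\le n-1),\quad d_n=\sigma_n(a,a),$$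 where $\sigma_0,\dots,\sigma_n$ are permutations of $\{0,1\}$ an odd number of which are not the identity. $(01)^*$ is the automorphism of the free monoid $\{0,1\}^*$ interchanging the letters $0$ and $1$. For $\mathcal A=(Q_n,\{0,1\},\delta,\lambda)\in\mathfrak F$, the automaton $(01)[\mathcal A]=(Q_n,\{0,1\},\delta,(01)\lambda)$ has the same states and transitions, and its output function is that of $\mathcal A$ followed by the transposition $(01)$; thus $(01)[\mathcal A]_q=(01)^*\mathcal A_q$ (composition with $\mathcal A_q$ applied first). The family $\mathfrak F'$ is $\{(01)[\mathcal A]:\mathcal A\in\mathfrak F\}$. ''Elements $g_1,\dots,g_k$ freely generate a free product of $k$ cyclic groups of order two'' means that the group they generate is the free product of its subgroups $\langle g_i\rangle$, each of order two. *)

(* Defs.v *)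
From HB Require Import structures.
From mathcomp Require Import all_boot all_fingroup.
From mathcomp Require Import boolp classical_sets functions cardinality.

Set Implicit Arguments.
Unset Strict Implicit.
Unset Printing Implicit Defensive.

Local Open Scope classical_set_scope.
Local Open Scope group_scope.

(* The group of all bijections X -> X. Products are compositions of maps with
   the right factor applied first, unlike in {perm T}. *)
Section BijGroup.
Variable X : Type.

Record bijGroup := MkBij { sym_fun :> X -> X; sym_bij : bijective sym_fun }.

Lemma sym_inj (f g : bijGroup) : f =1 g -> f = g.
Proof.
case: f g => f fb [g gb] /= /funext fg; subst g.
by rewrite (Prop_irrelevance fb gb).
Qed.

HB.instance Definition _ := gen_eqMixin bijGroup.
HB.instance Definition _ := gen_choiceMixin bijGroup.

Lemma sym_inv_subproof (f : bijGroup) :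
  {g : bijGroup | cancel f g /\ cancel g f}.
Proof.
apply: cid; case: f => f [g fK gK].
by exists (MkBij (Bijective gK fK)).
Qed.

Definition sym_one : bijGroup := MkBij (Bijective (frefl id) (frefl id)).
Definition sym_mul (f g : bijGroup) : bijGroup := MkBij (bij_comp (sym_bij f) (sym_bij g)).
Definition sym_inv (f : bijGroup) : bijGroup := sval (sym_inv_subproof f).

Lemma sym_mulA : associative sym_mul.
Proof. by move=> f g h; apply: sym_inj. Qed.
Lemma sym_1mul : left_id sym_one sym_mul.
Proof. by move=> f; apply: sym_inj. Qed.
Lemma sym_mul1 : right_id sym_one sym_mul.
Proof. by move=> f; apply: sym_inj. Qed.
Lemma sym_mulV : left_inverse sym_one sym_inv sym_mul.
Proof.
move=> f; apply: sym_inj => x /=; rewrite /sym_inv.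
by case: (sym_inv_subproof f) => g [fK gK] /=.
Qed.
Lemma sym_Vmul : right_inverse sym_one sym_inv sym_mul.
Proof.
move=> f; apply: sym_inj => x /=; rewrite /sym_inv.
by case: (sym_inv_subproof f) => g [fK gK] /=.
Qed.

HB.instance Definition _ :=
  isGroup.Build bijGroup sym_mulA sym_1mul sym_mul1 sym_mulV sym_Vmul.

End BijGroup.

Section FreeProducts.
Variable G : groupType.
Implicit Types (S H P : set G) (x y : G).

Definition is_subgroup H : Prop :=
  H 1 /\ forall x y, H x -> H y -> H (x * y^-1).

Definition subgroup_gen S : set G := smallest is_subgroup S.

Definition cyclic_subgroup x : set G := subgroup_gen [set x].

Definition is_hom_on (K : groupType) H (f : G -> K) : Prop :=
  forall x y, H x -> H y -> f (x * y) = f x * f y.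

(* P, with the inclusions H i -> P, is the coproduct of the groups H i.
   A homomorphism defined on a subgroup of G is represented by a function on G
   whose values outside of that subgroup are irrelevant. *)
Definition is_free_product (I : Type) (H : I -> set G) P : Prop :=
  [/\ is_subgroup P,
      forall i, is_subgroup (H i) /\ H i `<=` P
    & forall (K : groupType) (f : I -> G -> K),
        (forall i, is_hom_on (H i) (f i)) ->
        exists phi : G -> K,
          [/\ is_hom_on P phi,
              forall i x, H i x -> phi x = f i x
            & forall psi : G -> K,
                is_hom_on P psi ->
                (forall i x, H i x -> psi x = f i x) ->
                forall x, P x -> psi x = phi x]].

Definition freely_generate_C2s (I : Type) (g : I -> G) : Prop :=
  (forall i, (cyclic_subgroup (g i) #= `I_2)%card) /\
  is_free_product (fun i => cyclic_subgroup (g i)) (subgroup_gen (range g)).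

End FreeProducts.

Record mealy (Q A : finType) := Mealy {
  trans : Q -> A -> Q;
  out : Q -> A -> A }.

Section Mealy.
Variables Q A : finType.
Implicit Types (M : mealy Q A) (q : Q).

Fixpoint act M q (w : seq A) : seq A :=
  if w is x :: u then out M q x :: act M (trans M q x) u else [::].

Definition invertible M : Prop := forall q, injective (out M q).

Lemma act_bij M (hM : invertible M) q : bijective (act M q).
Proof.
pose inv := fix inv q (w : seq A) : seq A :=
  if w is y :: u then
    let x := invF (hM q) y in x :: inv (trans M q x) u
  else [::].
exists (inv q) => w; elim: w q => [|x w IH] q //=.
  by rewrite invF_f IH.
by rewrite f_invF IH.
Qed.

Definition state_sym M (hM : invertible M) q : bijGroup (seq A) :=
  MkBij (act_bij hM q).

(* s[M]: the output function of M followed by s *)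
Definition relabel (s : {perm A}) M : mealy Q A :=
  Mealy (trans M) (fun q x => s (out M q x)).

Lemma relabel_invertible s M : invertible M -> invertible (relabel s M).
Proof. by move=> hM q x y /= /perm_inj /hM. Qed.

End Mealy.

(* s^*: the automorphism of the free monoid on A that extends s *)
Definition star_sym (A : finType) (s : {perm A}) : bijGroup (seq A) :=
  MkBij (Bijective (mapK (permK s)) (mapK (permKV s))).

(* The alphabet {0,1} is bool, with 0 = false and 1 = true. *)
Definition swap01 : {perm bool} := tperm false true.

(* q = s(r0, r1) *)
Definition wreath_eq (Q : finType) (M : mealy Q bool) (q : Q) (s : {perm bool})
    (r0 r1 : Q) : Prop :=
  [/\ forall x, out M q x = s x, trans M q false = r0 & trans M q true = r1].

(* st_d i is d_(i+1) *)
Inductive state (n : nat) := st_a | st_b | st_c | st_d of 'I_n.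
Arguments st_a {n}.
Arguments st_b {n}.
Arguments st_c {n}.

Definition state_code n (q : state n) : option (option (option 'I_n)) :=
  match q with
  | st_a => None
  | st_b => Some None
  | st_c => Some (Some None)
  | st_d i => Some (Some (Some i))
  end.
Definition state_decode n (o : option (option (option 'I_n))) : state n :=
  match o with
  | None => st_a
  | Some None => st_b
  | Some (Some None) => st_c
  | Some (Some (Some i)) => st_d i
  end.
Lemma state_codeK n : cancel (@state_code n) (@state_decode n).
Proof. by case. Qed.
Lemma state_decodeK n : cancel (@state_decode n) (@state_code n).
Proof. by case=> [[[]|]|]. Qed.

HB.instance Definition _ n := Equality.copy (state n) (can_type (@state_codeK n)).
HB.instance Definition _ n := Choice.copy (state n) (can_type (@state_codeK n)).
HB.instance Definition _ n := Countable.copy (state n) (can_type (@state_codeK n)).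
HB.instance Definition _ n : isFinite (state n) := CanIsFinite (@state_codeK n).

Lemma card_state n : #|{: state n}| = (n + 3)%N.
Proof.
rewrite (bij_eq_card (Bijective (@state_codeK n) (@state_decodeK n))).
by rewrite !card_option card_ord addn3.
Qed.

Definition family_F n (M : mealy (state n) bool) : Prop :=
  odd n /\
  exists s : 'I_n.+1 -> {perm bool},
    [/\ odd #|[pred i | s i != 1]|,
        wreath_eq M st_a swap01 st_c st_b,
        wreath_eq M st_b swap01 st_b st_c,
        forall i : 'I_n, i = 0%N :> nat ->
          wreath_eq M st_c (s ord0) (st_d i) (st_d i)
      & (forall i j : 'I_n, j = i.+1 :> nat ->
           wreath_eq M (st_d i) (s (lift ord0 i)) (st_d j) (st_d j)) /\
        (forall i : 'I_n, i.+1 = n ->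
           wreath_eq M (st_d i) (s (lift ord0 i)) st_a st_a)].

Definition family_F' n (M' : mealy (state n) bool) : Prop :=
  exists2 M, family_F M & M' = relabel swap01 M.

Lemma family_F_invertible n (M : mealy (state n) bool) :
  family_F M -> invertible M.
Proof.
case: n M => [|n] M [] // _ [s [_ [oa _ _] [ob _ _] Ec [Ed Ed']]] q x y.
suff [t Et] : exists t : {perm bool}, forall z, out M q z = t z.
  by rewrite !Et => /perm_inj.
case: q {x y} => [|||i]; [by exists swap01 | by exists swap01 | |].
  by case: (Ec ord0 erefl) => *; exists (s ord0).
have := ltn_ord i; rewrite leq_eqVlt => /orP[/eqP/Ed'[Eo _ _]|ltin].
  by exists (s (lift ord0 i)).
by case: (Ed i (Ordinal ltin) erefl) => *; exists (s (lift ord0 i)).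
Qed.

Lemma family_F'_invertible n (M' : mealy (state n) bool) :
  family_F' M' -> invertible M'.
Proof.
by case=> M /family_F_invertible hM ->; apply: relabel_invertible.
Qed.

(* Main.v *)
Require Import Defs.
From mathcomp Require Import all_boot all_fingroup.
From mathcomp Require Import boolp classical_sets functions cardinality.

(** Write e for the letterwise exchange of 0 and 1, and let q range over the
states of the relabelled automaton. Each of these n + 4 maps is an involution,
so that the claim amounts to this: no nonempty word w in them without two equal
adjacent letters acts trivially ([freely_generate_of_reduced]).

Dual point of view. On one letter every generator is t |-> t or t |-> ~t, and
the section of w along an input sequence s is a word sec w s of the same
length, with the letters e in the same places. Call s a loop at w when
sec w s = w. If some loop s at w meets an odd number of letter exchanges in
total, then s and its image under w contain different numbers of ones modulo 2,
hence w acts nontrivially. So the aim is a loop of odd flip count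
([odd_flips_loop]).

On states the input 0 acts by a permutation pi0, which fixes b and is a cycle
of odd length n + 2 on the other states, and the input 1 acts by pi1 = pi0
after the transposition tau = (a b). So pi0 is even and pi1 is odd: the number
of ones in a sequence is the sign of the permutation that the sequence induces
on the states. Relabelling makes a and b flip-free and, n being odd, leaves an
odd number of states that flip.

Two properties of w are proved together by induction on its length, the second
one for words that begin with a state.
- [full_last w]: the loops at w induce on a letter written after w every
  permutation of the states that fixes the last letter of w.
- [odd_loops w]: no nonzero combination of the parity of the length and the
  parity of the flip count vanishes on all loops at w.

From these to full_last (p :: w): a loop at w acts on a letter p written before
w and on a letter q written after w. By induction, for w and for the reversed
word, each of the two actions is the full symmetric group of its domain. The
joint action contains a pair of transpositions, because tau is induced
simultaneously at both ends of a word without a and b ([tau_loop]), and such a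
word is in the orbit of w. It also contains a pair of permutations with
different signs, because a loop at w has odd flip count. By a Goursat type
argument ([goursat_signs]) the joint action contains 1 x Sym, so that p can be
held fixed while q is permuted arbitrarily.

From w to odd_loops (w q): fix a loop s at w and add up the parity in question
over all admissible q. The sum is the sum over the cycles of the permutation
that s induces, and each cycle gives a loop at w q. An odd sum therefore yields
a loop that is odd. As the number of flipping states is odd and the number of
states is even, the sums are parities that are already known not to vanish
([chi_sum], [chi_sum_but_last]). The induction starts from words of at most two
letters, where explicit loops serve ([full_last_letter], [odd_loops_letter],
[nonflip_pair_loop]). *)

Set Implicit Arguments.
Unset Strict Implicit.
Unset Printing Implicit Defensive.

(** * Permutations fixing at most one prescribed point *)
Section FixingPerms.
Local Open Scope group_scope.
Variables (T : finType) (o : option T).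
Implicit Types (s t : {perm T}) (M N : {perm T} -> Prop).

(** The domains of interest are a whole finite type, when [o] is [None], and a
finite type without one point [y], when [o] is [Some y]; [Some x != o] says that
[x] lies in the domain. *)
Definition fixes s := omap s o = o.

Lemma fixes1 : fixes 1.
Proof. by rewrite /fixes; case: o => //= x; rewrite perm1. Qed.

Lemma fixesM s t : fixes s -> fixes t -> fixes (s * t).
Proof. by rewrite /fixes; case: o => //= x [h1] [h2]; rewrite permM h1 h2. Qed.

Lemma fixesV s : fixes s -> fixes s^-1.
Proof. by rewrite /fixes; case: o => //= x [h1]; rewrite -{1}h1 permK. Qed.

Lemma fixes_tperm x y : Some x != o -> Some y != o -> fixes (tperm x y).
Proof.
by rewrite /fixes; case: o => //= z hx hy; rewrite tpermD.
Qed.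

Lemma fixes_neq s x : fixes s -> Some x != o -> Some (s x) != o.
Proof.
rewrite /fixes; case: o => //= z [hz]; apply: contra => /eqP[].
by rewrite -{1}hz => /perm_inj->.
Qed.

Lemma moved_allowed s x : fixes s -> s x != x -> Some x != o.
Proof.
rewrite /fixes; case: o => //= z [hz]; apply: contra => /eqP[->].
by rewrite hz.
Qed.

Lemma neq1_moved s : s != 1 -> exists x, s x != x.
Proof.
move=> h; apply/existsP; apply: contraNT h => /existsPn h.
by apply/eqP/permP => x; rewrite perm1; apply/eqP; move: (h x); rewrite negbK.
Qed.

(** Transpositions inside the domain generate: composing [s] with the
transposition of [x] and [s x] turns [x] into a fixed point and creates no moved
point. *)
Lemma fixing_perm_ind M : M 1 ->
  (forall s x y, Some x != o -> Some y != o -> x != y -> fixes s ->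
     M s -> M (s * tperm x y)) ->
  forall s, fixes s -> M s.
Proof.
move=> M1 MM s; have [m] := ubnP #|[pred x | s x != x]|.
elim: m s => // m IH s hm fs.
have [->//|/neq1_moved[x hx]] := eqVneq s 1.
have ox := moved_allowed fs hx.
have osx : Some (s x) != o by apply: fixes_neq.
have ft := fixes_tperm ox osx.
rewrite -[s]mulg1 -(tperm2 x (s x)) mulgA; apply: MM => //.
- by rewrite eq_sym.
- exact: fixesM.
apply: IH; last exact: fixesM.
rewrite -ltnS; apply: leq_trans hm; rewrite ltnS; apply: proper_card.
apply/properP; split; last first.
  by exists x; rewrite !inE // permM tpermR eqxx.
apply/fintype.subsetP => y; rewrite !inE permM; apply: contra => /eqP hy.
rewrite hy; case: tpermP => [yx|ysx|_ _]; rewrite ?hy //.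
  by rewrite -yx hy.
by move: hy hx; rewrite ysx => /perm_inj->; rewrite eqxx.
Qed.

Lemma fixing_3transitive a b c a' b' c' :
  uniq [:: a; b; c] -> uniq [:: a'; b'; c'] ->
  all (fun x => Some x != o) [:: a; b; c; a'; b'; c'] ->
  exists s, [/\ fixes s, s a = a', s b = b' & s c = c'].
Proof.
rewrite /= !inE !negb_or !andbT => /andP[/andP[ab ac] bc].
move=> /andP[/andP[ab' ac'] bc'] /and5P[oa ob oc oa' /andP[ob' oc']].
pose s1 := tperm a a'; pose s2 := s1 * tperm (s1 b) b'.
have f1 : fixes s1 by apply: fixes_tperm.
have f2 : fixes s2 by apply/(fixesM f1)/fixes_tperm => //; apply: fixes_neq.
have s1a : s1 a = a' by rewrite tpermL.
have s2a : s2 a = a'.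
  rewrite permM s1a tpermD //; last by rewrite eq_sym.
  by rewrite -s1a (inj_eq perm_inj) eq_sym.
have s2b : s2 b = b' by rewrite permM tpermL.
exists (s2 * tperm (s2 c) c'); split.
- by apply/(fixesM f2)/fixes_tperm => //; apply: fixes_neq.
- rewrite permM s2a tpermD //; last by rewrite eq_sym.
  by rewrite -s2a (inj_eq perm_inj) eq_sym.
- rewrite permM s2b tpermD //; last by rewrite eq_sym.
  by rewrite -s2b (inj_eq perm_inj) eq_sym.
by rewrite permM tpermL.
Qed.

Section Normal.
Variable N : {perm T} -> Prop.
Hypothesis N1 : N 1.
Hypothesis NM : forall s t, N s -> N t -> N (s * t).
Hypothesis NJ : forall s t, fixes t -> N s -> N (s ^ t).

Lemma closedX s k : N s -> N (s ^+ k).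
Proof. by move=> h; elim: k => // k IH; rewrite expgS; apply: NM. Qed.

Lemma closedV s : N s -> N s^-1.
Proof. by move=> h; rewrite invg_expg; apply: closedX. Qed.

Lemma normal_tperm x y s : Some x != o -> Some y != o -> x != y ->
  N (tperm x y) -> fixes s -> N s.
Proof.
move=> ox oy xy Nxy; apply: fixing_perm_ind => // {}s u v ou ov uv _ Ns.
apply: NM => //; pose g := tperm x u * tperm (tperm x u y) v.
have fxu : fixes (tperm x u) by apply: fixes_tperm.
have gx : g x = u.
  rewrite permM tpermL tpermD //; last by rewrite eq_sym.
  by rewrite -{2}(tpermL x u) (inj_eq perm_inj) eq_sym.
have gy : g y = v by rewrite permM tpermL.
rewrite -gx -gy -tpermJ; apply: NJ => //.
by apply/(fixesM fxu)/fixes_tperm => //; apply: fixes_neq.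
Qed.

(** A product of two transpositions is a product of at most two 3-cycles, so that
a normal subgroup with one 3-cycle contains all even permutations; an odd
element then adds the odd ones. *)
Lemma normal_3cycle a b c b0 s :
  uniq [:: a; b; c] -> all (fun x => Some x != o) [:: a; b; c] ->
  N (tperm a b * tperm a c) -> odd_perm b0 -> N b0 -> fixes b0 ->
  fixes s -> N s.
Proof.
move=> uabc oabc Nabc oddb Nb fb.
have N3 x y z : uniq [:: x; y; z] -> all (fun x => Some x != o) [:: x; y; z] ->
    N (tperm x y * tperm x z).
  move=> uxyz oxyz.
  have [//|//||g [fg <- <- <-]] := @fixing_3transitive a b c x y z.
      by move: oabc oxyz => /= /and4P[-> -> -> _].
  by rewrite -!tpermJ -conjMg; apply: NJ.
have N4 x y z u : all (fun x => Some x != o) [:: x; y; z; u] ->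
    x != y -> z != u -> N (tperm x y * tperm z u).
  move=> /= /and5P[ox oy oz ou _] xy zu.
  have N4x p q r : all (fun x => Some x != o) [:: p; q; r] ->
      p != q -> p != r -> N (tperm p q * tperm p r).
    move=> /= /and4P[op oq or _] pq pr.
    have [<-|qr] := eqVneq q r; first by rewrite tperm2.
    by apply: N3 => /=; rewrite ?inE ?negb_or ?pq ?pr ?qr ?op ?oq ?or.
  have [xz|xz] := eqVneq x z.
    by rewrite -xz in zu *; apply: N4x; rewrite //= ox oy ou.
  have -> : tperm x y * tperm z u =
      (tperm x y * tperm x z) * (tperm z x * tperm z u).
    by rewrite -mulgA (mulgA (tperm x z)) (tpermC z x) tperm2 mul1g.
  by apply: NM; apply: N4x; rewrite //= ?ox ?oy ?oz ?ou // eq_sym.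
have even_odd : forall t, fixes t -> forall x y, Some x != o -> Some y != o ->
    x != y -> N (if odd_perm t then t * tperm x y else t).
  apply: fixing_perm_ind => [|{s}s u v ou ov uv fs IH] x y ox oy xy.
    by rewrite odd_perm1.
  rewrite odd_permM odd_tperm uv addbT; case: ifP => hs.
    rewrite -mulgA; apply: NM; last by apply: N4; rewrite //= ou ov ox oy.
    by move: (IH u v ou ov uv); rewrite (negbTE hs).
  by move: (IH u v ou ov uv); rewrite (negbFE hs).
have even t : fixes t -> ~~ odd_perm t -> N t.
  move: uabc oabc => /=; rewrite inE negb_or => /andP[/andP[ab _] _].
  move=> /and3P[oa ob _] ft ht.
  by move: (even_odd t ft a b oa ob ab); rewrite (negbTE ht).
move=> fs; have [hs|] := boolP (odd_perm s); last exact: even.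
rewrite -[s](mulgKV b0); apply: NM => //; apply: even.
  by apply: fixesM => //; apply: fixesV.
by rewrite odd_permM odd_permV hs oddb.
Qed.

(** Oddness is what excludes the Klein four-group on four points. If the odd element [b0] is not an involution, its commutator with a
transposition is a 3-cycle. If it is an involution but not a transposition, it
consists of at least three transpositions, and two commutators lead from it to
a double transposition and from there to a 3-cycle. *)
Lemma normal_odd_full b0 s : odd_perm b0 -> N b0 -> fixes b0 -> fixes s -> N s.
Proof.
move=> oddb Nb fb fs.
have mv := moved_allowed fb.
have [x hx] : exists x, b0 x != x.
  by apply: neq1_moved; apply: contraTneq oddb => ->; rewrite odd_perm1.
have ox := mv x hx; pose y := b0 x.
have oy : Some y != o by apply: fixes_neq.
have [/existsP[{hx ox y oy}x hx]|] := boolP [exists x, b0 (b0 x) != x].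
  pose y := b0 x; pose z := b0 y.
  have xy : y != x by apply: contra hx => /eqP h; rewrite [b0 x]h [b0 x]h.
  have ox := mv x xy; have oy : Some y != o by apply: fixes_neq.
  have oz : Some z != o by apply: fixes_neq.
  have yz : z != y by rewrite (inj_eq perm_inj).
  apply: (@normal_3cycle y z x b0) => //=.
  - by rewrite !inE !negb_or xy hx eq_sym yz.
  - by rewrite ox oy oz.
  have -> : tperm y z * tperm y x = b0^-1 * b0 ^ tperm x y.
    rewrite /conjg tpermV !mulgA (tpermC y x); congr (_ * _).
    by rewrite -mulgA -[_ * (_ * _)]/(tperm x y ^ b0) tpermJ.
  by apply: NM; [exact: closedV|apply: NJ => //; exact: fixes_tperm].
move=> /existsPn inv; have {}inv p : b0 (b0 p) = p.
  by apply/eqP; rewrite -[_ == _]negbK inv.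
(* Either b0 is the transposition (x y), or it moves some z outside {x, y}. *)
have [bE|/neq1_moved[z]] := eqVneq (b0 * tperm x y) 1.
  apply: (@normal_tperm x y) => //; first by rewrite eq_sym.
  suff <- : b0 = tperm x y by [].
  by rewrite -[LHS]mulg1 -(tperm2 x y) mulgA bE mul1g.
have bx : b0 x = y by []. have bY : b0 y = x by rewrite /y inv.
rewrite permM => hz; pose u := b0 z.
have bu : b0 u = z by rewrite /u inv.
have xz : x != z by apply: contraNneq hz => <-; rewrite bx tpermR.
have yz : y != z by apply: contraNneq hz => <-; rewrite bY tpermL.
have uz : u != z by apply: contraNneq hz => h; rewrite -[b0 z]/u h tpermD.
have xu : x != u by rewrite -bY (inj_eq perm_inj).
have yu : y != u by rewrite -bx (inj_eq perm_inj).
have oz := mv z uz; have ou : Some u != o by apply: fixes_neq.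
(* By parity b0 is not the product of (x y) and (z u): there is a fifth moved
   point v. *)
have [v] : exists v, (b0 * tperm x y * tperm z u) v != v.
  apply: neq1_moved; apply/eqP => h.
  have := congr1 (@odd_perm T) h; rewrite !odd_permM !odd_tperm odd_perm1.
  by rewrite oddb (eq_sym x) hx (eq_sym z) uz.
rewrite !permM => hv.
have xv : x != v.
  by apply: contraNneq hv => <-; rewrite bx tpermR tpermD // eq_sym.
have yv : y != v.
  by apply: contraNneq hv => <-; rewrite bY tpermL tpermD // eq_sym.
have zv : z != v.
  by apply: contraNneq hv => <-; rewrite -[b0 z]/u (tpermD xu yu) tpermR.
have uv : u != v.
  by apply: contraNneq hv => <-; rewrite bu (tpermD xz yz) tpermL.
have ov : Some v != o.
  by apply: mv; apply: contraNneq hv => ->; rewrite !tpermD.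
have Ng : N (tperm x u * tperm y z).
  have -> : tperm x u * tperm y z = b0 * b0 ^ tperm y z.
    rewrite /conjg tpermV !mulgA; congr (_ * _).
    have {1}-> : b0 = b0^-1.
      by apply/permP => p; apply: (@perm_inj _ b0); rewrite permKV inv.
    by rewrite -mulgA -[_ * (_ * _)]/(tperm y z ^ b0) tpermJ bY.
  by apply: NM => //; apply: NJ => //; exact: fixes_tperm.
apply: (@normal_3cycle x u v b0) => //=.
- by rewrite !inE !negb_or xu xv uv.
- by rewrite ox ou ov.
have -> : tperm x u * tperm x v =
    (tperm x u * tperm y z) * (tperm x u * tperm y z) ^ tperm u v.
  have Tx : tperm u v x = x by rewrite tpermD // eq_sym.
  have Ty : tperm u v y = y by rewrite tpermD // eq_sym.
  have Tz : tperm u v z = z by rewrite tpermD // eq_sym.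
  rewrite conjMg !tpermJ tpermL Tx Ty Tz -!mulgA; congr (_ * _).
  rewrite mulgA -{1}(tpermV y z) -mulgA -[RHS]/(_ ^ _) tpermJ.
  by rewrite !tpermD // eq_sym.
by apply: NM => //; apply: NJ => //; exact: fixes_tperm.
Qed.

End Normal.
End FixingPerms.

(** * Subgroups of a product of two symmetric groups *)
Section Goursat.
Local Open Scope group_scope.
Variables (T : finType) (oA oB : option T) (P : {perm T} -> {perm T} -> Prop).
Hypothesis P1 : P 1 1.
Hypothesis PM : forall s t s' t', P s s' -> P t t' -> P (s * t) (s' * t').
Hypothesis Pfix : forall s s', P s s' -> fixes oA s /\ fixes oB s'.
Hypothesis PA : forall s, fixes oA s -> exists s', P s s'.
Hypothesis PB : forall s', fixes oB s' -> exists s, P s s'.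

Lemma goursatX s s' k : P s s' -> P (s ^+ k) (s' ^+ k).
Proof. by move=> h; elim: k => // k IH; rewrite !expgS; apply: PM. Qed.

Lemma goursatV s s' : P s s' -> P s^-1 s'^-1.
Proof.
move=> h; set k := (#[s] * #[s']).-1.
have e (t : {perm T}) : #[t] %| #[s] * #[s'] -> t^-1 = t ^+ k.
  move=> /dvdnP[m hm]; apply: (mulgI t).
  rewrite mulgV -expgS prednK ?muln_gt0 ?order_gt0 // hm mulnC expgM.
  by rewrite expg_order expg1n.
rewrite (e s) ?dvdn_mulr // (e s') ?dvdn_mull //; exact: goursatX.
Qed.

Lemma goursatJ s s' t t' : P s s' -> P t t' -> P (s ^ t) (s' ^ t').
Proof. by move=> h k; apply: PM; [exact: goursatV|exact: PM]. Qed.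

(** Conjugating the given pair of transpositions shows that every permutation of
the first domain is the first component of a pair with equal signs. Dividing a
pair with different signs by such a pair gives [(1, d)] with [d] odd, and the
second components of the pairs over 1 form a normal subgroup. *)
Lemma goursat_signs x y u v : x != y -> u != v ->
  P (tperm x y) (tperm u v) ->
  (exists s s', P s s' /\ odd_perm s != odd_perm s') ->
  forall s', fixes oB s' -> P 1 s'.
Proof.
move=> xy uv Pt [d [d' [Pd odd_d]]] s' fs'.
have ox : Some x != oA.
  by apply: (moved_allowed (proj1 (Pfix Pt))); rewrite tpermL eq_sym.
have oy : Some y != oA.
  by apply: (moved_allowed (proj1 (Pfix Pt))); rewrite tpermR.
pose N s := exists s1, P s s1 /\ odd_perm s = odd_perm s1.
have Nall : forall s, fixes oA s -> N s.
  move=> s; apply: (@normal_tperm _ oA N _ _ _ x y) => //.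
  - by exists 1; rewrite !odd_perm1.
  - move=> s1 s2 [t1 [h1 e1]] [t2 [h2 e2]]; exists (t1 * t2).
    by rewrite !odd_permM e1 e2; split=> //; apply: PM.
  - move=> s1 g /PA[g' hg] [t1 [h1 e1]]; exists (t1 ^ g').
    by rewrite !odd_permJ; split=> //; apply: goursatJ.
  by exists (tperm u v); rewrite !odd_tperm xy uv.
have [fd fd'] := Pfix Pd.
have [d1 [Pd1 e1]] := Nall _ (fixesV fd).
apply: (@normal_odd_full _ oB (P 1) _ _ _ (d1 * d')) => //.
- by move=> s1 s2 h1 h2; rewrite -[1]mulg1; apply: PM.
- by move=> s1 g /PB[g0 hg] h1; rewrite -(conj1g g0); apply: goursatJ.
- rewrite odd_permM -e1 odd_permV; move: odd_d.
  by case: (odd_perm d); case: (odd_perm d').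
- by rewrite -(mulVg d); apply: PM.
by apply: fixesM => //; case: (Pfix Pd1).
Qed.
End Goursat.

(** * Sums of parities over cycles *)
Section ParitySums.
Local Open Scope group_scope.

Lemma big_addb_card (T : finType) (P : pred T) :
  \big[addb/false]_x P x = odd #|P|.
Proof.
rewrite -sum1_card (big_morph odd oddD (erefl : odd 0 = false)) [RHS]big_mkcond.
by apply: eq_bigr => x _; rewrite unfold_in; case: (P x).
Qed.

Lemma big_traject (T : Type) (f : T -> T) x n (c : T -> bool) :
  \big[addb/false]_(y <- traject f x n) c y =
  \big[addb/false]_(0 <= i < n) c (iter i f x).
Proof.
suff -> : traject f x n = [seq iter i f x | i <- index_iota 0 n].
  by rewrite big_map.
apply: (@eq_from_nth _ x) => [|i].
  by rewrite size_traject size_map size_iota subn0.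
rewrite size_traject => hi.
rewrite nth_traject // (nth_map 0%N) ?size_iota ?subn0 //.
by rewrite /index_iota subn0 nth_iota.
Qed.

Lemma odd_cycle (T : finType) (c : T -> bool) (p : {perm T}) :
  \big[addb/false]_x c x ->
  exists x, \big[addb/false]_(0 <= i < #|porbit p x|) c ((p ^+ i) x).
Proof.
move=> h; apply/existsP; apply: contraLR h => /existsPn h.
rewrite (partition_big (porbit p) (mem (porbits p))) /=; last first.
  by move=> x _; apply/imsetP; exists x.
rewrite big1 // => O /imsetP[x _ ->].
rewrite (eq_bigl (mem (traject p x #|porbit p x|))) => [|y]; last first.
  by rewrite eq_porbit_mem porbit_traject.
rewrite -big_uniq ?uniq_traject_porbit //=; apply/negbTE; move: (h x).
by under eq_bigr do rewrite permX; rewrite big_traject.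
Qed.

End ParitySums.

(** * Recognizing free products of groups of order two *)
Section Words.
Local Open Scope group_scope.
Variable I : eqType.

Fixpoint weval (K : groupType) (h : I -> K) (w : seq I) : K :=
  if w is i :: w' then h i * weval h w' else 1.

Lemma weval_cat (K : groupType) (h : I -> K) w1 w2 :
  weval h (w1 ++ w2) = weval h w1 * weval h w2.
Proof. by elim: w1 => [|i w1 IH] /=; rewrite ?mul1g // IH mulgA. Qed.

Lemma weval_rev (K : groupType) (h : I -> K) w : (forall i, h i * h i = 1) ->
  weval h (rev w) = (weval h w)^-1.
Proof.
move=> hh; elim: w => [|i w IH]; first by rewrite invg1.
rewrite rev_cons -cats1 weval_cat IH /= mulg1 invMg; congr (_ * _).
by apply: (mulgI (h i)); rewrite hh mulgV.
Qed.

Lemma not_sorted_split w : ~~ sorted (fun i j : I => i != j) w ->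
  exists u i v, w = u ++ i :: i :: v.
Proof.
elim: w => // i [|j w] //= IH; rewrite negb_and negbK.
case: eqVneq => [<- _|_ /= /IH[u [k [v ->]]]]; first by exists [::], i, w.
by exists (i :: u), k, v.
Qed.

Section FreeProductCriterion.
Local Open Scope classical_set_scope.
Variables (G : groupType) (g : I -> G).
Hypothesis gg : forall i, g i * g i = 1.
Hypothesis g_reduced : forall w, sorted (fun i j => i != j) w -> 0 < size w ->
  weval g w != 1.

(** A word with value 1 in [G] is not reduced unless it is empty, and cancelling
two equal adjacent letters changes no value in any group in which the letters
are involutions. *)
Lemma weval_transfer (K : groupType) (h : I -> K) w :
  (forall i, h i * h i = 1) -> weval g w = 1 -> weval h w = 1.
Proof.
move=> hh; have [k] := ubnP (size w); elim: k w => // k IH w hk e.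
have [rw|/not_sorted_split[u [i [v wE]]]] :=
    boolP (sorted (fun i j : I => i != j) w).
  case: (posnP (size w)) => [/size0nil->//|w0].
  by have := g_reduced rw w0; rewrite e eqxx.
have cancel (K' : groupType) (h' : I -> K') : (forall i, h' i * h' i = 1) ->
    weval h' w = weval h' (u ++ v).
  by move=> hh'; rewrite wE !weval_cat /= (mulgA (h' i)) hh' mul1g.
rewrite cancel //; apply: IH; last by rewrite -cancel.
by move: hk; rewrite wE !size_cat /= !addnS ltnS; apply: ltnW.
Qed.

Lemma subgroup_genP x : subgroup_gen (range g) x <-> exists w, x = weval g w.
Proof.
split.
  move=> hx; apply: (hx [set y | exists w, y = weval g w]).
  split=> [|y [i _ <-]]; last by exists [:: i]; rewrite /= mulg1.
  split; first by exists [::].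
  by move=> y z [v ->] [w ->]; exists (v ++ rev w); rewrite weval_cat weval_rev.
move=> [w ->] H [[H1 HM] gH]; elim: w => [|i w IH] /=; first exact: H1.
have Hg : H (g i) by apply: gH; exists i.
rewrite -(invgK (weval g w)); apply: (HM) => //.
by rewrite -[_^-1]mul1g; apply: HM.
Qed.

Lemma cyclic_subgroupP i x : cyclic_subgroup (g i) x <-> x = 1 \/ x = g i.
Proof.
have gV : (g i)^-1 = g i by apply: (mulgI (g i)); rewrite gg mulgV.
split.
  move=> hx; apply: (hx [set y | y = 1 \/ y = g i]).
  split=> [|y ->]; last by right.
  split; first by left.
  move=> y z [->|->] [->|->]; rewrite ?invg1 ?gV ?mul1g ?mulg1 ?gg;
    by [left|right].
by move=> [->|->] H [[H1 HM] gH] //; apply: gH.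
Qed.

Lemma is_subgroup_gen (S : set G) : is_subgroup (subgroup_gen S).
Proof.
split=> [H [[]]//|x y hx hy H hH]; have [[_ HM] _] := hH.
by apply: HM; [apply: (hx H hH)|apply: (hy H hH)].
Qed.

Lemma card_cyclic_subgroup i : (cyclic_subgroup (g i) #= `I_2)%card.
Proof.
have g1 : g i != 1 by have := @g_reduced [:: i] isT isT; rewrite /= mulg1.
apply/card_set_bijP; exists (fun x => (x != 1 : nat)); split.
- by move=> x _; case: (x != 1).
- move=> x y; rewrite !inE.
  move=> /cyclic_subgroupP[->|->] /cyclic_subgroupP[->|->] //;
    by rewrite eqxx g1.
move=> [|[|//]] _.
  by exists 1; [apply/cyclic_subgroupP; left|rewrite eqxx].
by exists (g i); [apply/cyclic_subgroupP; right|rewrite g1].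
Qed.

Lemma hom_on1 (K : groupType) (H : set G) (f : G -> K) :
  H 1 -> is_hom_on H f -> f 1 = 1.
Proof. by move=> H1 hf; apply: (mulgI (f 1)); rewrite -hf // !mulg1. Qed.

(** The common extension of homomorphisms on the factors is given by evaluating
words; by [weval_transfer] the result depends only on the element of [G] that
the word represents. *)
Lemma freely_generate_of_reduced : freely_generate_C2s g.
Proof.
split; first exact: card_cyclic_subgroup.
split; first exact: is_subgroup_gen.
  move=> i; split; first exact: is_subgroup_gen.
  move=> x /cyclic_subgroupP[->|->]; apply/subgroup_genP; first by exists [::].
  by exists [:: i]; rewrite /= mulg1.
move=> K f hf; pose h i := f i (g i).
have c1 i : cyclic_subgroup (g i) 1 by apply/cyclic_subgroupP; left.
have cg i : cyclic_subgroup (g i) (g i) by apply/cyclic_subgroupP; right.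
have f1 i : f i 1 = 1 by apply: hom_on1 (hf i).
have hh i : h i * h i = 1 by rewrite /h -(hf i) // gg.
have wd v w : weval g v = weval g w -> weval h v = weval h w.
  move=> e; apply: (mulIg (weval h w)^-1); rewrite mulgV.
  rewrite -weval_rev // -weval_cat; apply: weval_transfer => //.
  by rewrite weval_cat weval_rev // e mulgV.
(* Outside the generated subgroup the value of phi is immaterial. *)
have /choice[phi phiE] : forall x, exists y,
    forall w, x = weval g w -> y = weval h w.
  move=> x; have [[w ->]|nw] := pselect (exists w, x = weval g w).
    by exists (weval h w) => v; apply: wd.
  by exists 1 => w e; case: nw; exists w.
exists phi; split.
- move=> x y /subgroup_genP[v xv] /subgroup_genP[w yw].
  rewrite (phiE _ _ xv) (phiE _ _ yw) -weval_cat; apply: phiE.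
  by rewrite weval_cat -xv -yw.
- move=> i x /cyclic_subgroupP[->|->].
    by rewrite f1; apply: (phiE _ [::]).
  by rewrite (phiE _ [:: i]) /= mulg1.
move=> psi hpsi psiE x /subgroup_genP[w xw]; rewrite (phiE _ _ xw) xw.
have P v : subgroup_gen (range g) (weval g v) by apply/subgroup_genP; exists v.
elim: w {x xw} => [|i w IH] /=; first exact: hom_on1 (P [::]) hpsi.
have Pg : subgroup_gen (range g) (g i) by have := P [:: i]; rewrite /= mulg1.
by rewrite hpsi // IH (psiE i).
Qed.
End FreeProductCriterion.
End Words.
Unset Printing Implicit Defensive.

(** * Words of letters and their sections *)

(** [Some q] stands for the state [q], which acts on one input bit by exchanging
0 and 1 if [fl q] holds and has the section [pi t q] at the input [t]; [None]
stands for the letterwise exchange, which is its own section. The first letter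
of a word acts first. *)
Section Dual.
Local Open Scope group_scope.
Variables (Q : finType) (pi : bool -> {perm Q}) (fl : pred Q).
Implicit Types (w : seq (option Q)) (x : option Q) (s : seq bool).

Definition flips x := if x is Some q then fl q else true.
Fixpoint parity w := if w is x :: w' then flips x (+) parity w' else false.
Fixpoint step t w :=
  if w is x :: w' then omap (pi t) x :: step (t (+) flips x) w' else [::].
Definition sec w s := foldl (fun w t => step t w) w s.
Fixpoint outs w s :=
  if s is t :: s' then (t (+) parity w) :: outs (step t w) s' else [::].
Fixpoint flips_along w s :=
  if s is t :: s' then parity w (+) flips_along (step t w) s' else false.
Fixpoint path_perm s : {perm Q} :=
  if s is t :: s' then pi t * path_perm s' else 1.

Definition loop w s := sec w s = w.

Lemma sec_cat w s1 s2 : sec w (s1 ++ s2) = sec (sec w s1) s2.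
Proof. exact: foldl_cat. Qed.

Lemma outs_cat w s1 s2 : outs w (s1 ++ s2) = outs w s1 ++ outs (sec w s1) s2.
Proof. by elim: s1 w => //= t s1 IH w; rewrite IH. Qed.

Lemma flips_along_cat w s1 s2 :
  flips_along w (s1 ++ s2) = flips_along w s1 (+) flips_along (sec w s1) s2.
Proof. by elim: s1 w => //= t s1 IH w; rewrite IH addbA. Qed.

Lemma path_perm_cat s1 s2 : path_perm (s1 ++ s2) = path_perm s1 * path_perm s2.
Proof. by elim: s1 => [|t s1 IH] /=; rewrite ?mul1g // IH mulgA. Qed.

Lemma size_outs w s : size (outs w s) = size s.
Proof. by elim: s w => //= t s IH w; rewrite IH. Qed.

Lemma parity_cat w1 w2 : parity (w1 ++ w2) = parity w1 (+) parity w2.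
Proof. by elim: w1 => //= x w1 ->; rewrite addbA. Qed.

Lemma step_cat t w1 w2 :
  step t (w1 ++ w2) = step t w1 ++ step (t (+) parity w1) w2.
Proof.
by elim: w1 t => [|x w1 IH] t /=; rewrite ?addbF // IH addbA.
Qed.

Lemma sec_wcat w1 w2 s : sec (w1 ++ w2) s = sec w1 s ++ sec w2 (outs w1 s).
Proof. by elim: s w1 w2 => //= t s IH w1 w2; rewrite step_cat IH. Qed.

Lemma outs_wcat w1 w2 s : outs (w1 ++ w2) s = outs w2 (outs w1 s).
Proof.
by elim: s w1 w2 => //= t s IH w1 w2; rewrite step_cat IH parity_cat addbA.
Qed.

Lemma flips_along_wcat w1 w2 s :
  flips_along (w1 ++ w2) s = flips_along w1 s (+) flips_along w2 (outs w1 s).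
Proof.
elim: s w1 w2 => //= t s IH w1 w2; rewrite step_cat IH parity_cat.
by rewrite -!addbA; congr (_ (+) _); rewrite addbCA.
Qed.

Lemma sec_nil s : sec [::] s = [::].
Proof. by elim: s. Qed.

Lemma outs_nil s : outs [::] s = s.
Proof. by elim: s => //= t s ->; rewrite addbF. Qed.

Lemma flips_along_nil s : flips_along [::] s = false.
Proof. by elim: s. Qed.

Lemma sec_letter x s : sec [:: x] s = [:: omap (path_perm s) x].
Proof.
elim: s x => [|t s IH] x /=; first by case: x => //= q; rewrite perm1.
by rewrite IH; case: x => //= q; rewrite permM.
Qed.

Lemma sec_cons x w s :
  sec (x :: w) s = omap (path_perm s) x :: sec w (outs [:: x] s).
Proof. by rewrite -cat1s sec_wcat sec_letter. Qed.

Lemma sec_rcons w x s :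
  sec (rcons w x) s = rcons (sec w s) (omap (path_perm (outs w s)) x).
Proof. by rewrite -cats1 sec_wcat sec_letter cats1. Qed.

Lemma outs_None s : outs [:: None] s = map negb s.
Proof. by elim: s => //= t s ->; rewrite addbT. Qed.

Lemma flips_along_None s : flips_along [:: None] s = odd (size s).
Proof. by elim: s => //= t s ->. Qed.

Fixpoint rep k s := if k is k'.+1 then s ++ rep k' s else [::].

Lemma path_perm_rep k s : path_perm (rep k s) = path_perm s ^+ k.
Proof. by elim: k => //= k IH; rewrite path_perm_cat IH expgS. Qed.

Lemma size_rep k s : size (rep k s) = (k * size s)%N.
Proof. by elim: k => //= k IH; rewrite size_cat IH. Qed.

Lemma rep_mul k m s : rep (k * m) s = rep k (rep m s).
Proof.
have pwD i j : rep (i + j) s = rep i s ++ rep j s.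
  by elim: i => //= i IH; rewrite IH catA.
by elim: k => //= k IH; rewrite mulSn pwD IH.
Qed.

Lemma loop_rep w s k : loop w s -> loop w (rep k s).
Proof. by move=> h; elim: k => //= k IH; rewrite /loop sec_cat h. Qed.

Lemma outs_rep w s k : loop w s -> outs w (rep k s) = rep k (outs w s).
Proof. by move=> h; elim: k => //= k IH; rewrite outs_cat h IH. Qed.

Lemma loop_cat w s1 s2 : loop w s1 -> loop w s2 -> loop w (s1 ++ s2).
Proof. by rewrite /loop sec_cat => ->. Qed.

(** Every letter has finite order under the dual action; the periods of the
letters of [w] are found from left to right, each one on the input sequence that
the preceding letters put out. *)
Lemma loop_rep_exists w s : exists2 k, 0 < k & loop w (rep k s).
Proof.
elim: w s => [|x w IH] s; first by exists 1%N => //; rewrite /loop sec_nil.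
pose m := #[path_perm s]; have Lx : loop [:: x] (rep m s).
  rewrite /loop sec_letter path_perm_rep expg_order.
  by case: x => //= q; rewrite perm1.
have [k k0 Lk] := IH (outs [:: x] (rep m s)).
exists (k * m)%N; first by rewrite muln_gt0 k0 order_gt0.
rewrite /loop -cat1s sec_wcat rep_mul; congr (_ ++ _); first exact: loop_rep.
by rewrite outs_rep.
Qed.

(** Loops form a monoid only, but a power of [s] undoes [s] in every respect that
matters below, so that loops can be conjugated by arbitrary paths. *)
Lemma path_return w s : exists r,
  [/\ loop w (s ++ r), path_perm (s ++ r) = 1, path_perm (outs w (s ++ r)) = 1
    & ~~ odd (size (s ++ r))].
Proof.
have [k k0 Lk] := loop_rep_exists w s.
set u := rep k s in Lk.
pose o1 := #[path_perm u]; pose o2 := #[path_perm (outs w u)].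
pose m := (2 * (o1 * o2))%N.
have m0 : 0 < m * k by rewrite !muln_gt0 !order_gt0 k0.
exists (rep (m * k).-1 s).
rewrite -[s ++ _]/(rep (m * k).-1.+1 s) prednK // rep_mul -/u.
split.
- exact: loop_rep.
- by rewrite path_perm_rep /m mulnCA expgM expg_order expg1n.
- by rewrite outs_rep // path_perm_rep /m mulnA mulnC expgM expg_order expg1n.
by rewrite size_rep /m -!mulnA mul2n odd_double.
Qed.

(** The three nonzero choices of [i] and [j] give all nontrivial combinations of
the parity of the length and of the parity of the flip count; on the loops at
[w] they are homomorphisms to the group of order two. *)
Definition chi (i j : bool) w s :=
  (i && odd (size s)) (+) (j && flips_along w s).

Lemma chi_cat i j w s1 s2 :
  chi i j w (s1 ++ s2) = chi i j w s1 (+) chi i j (sec w s1) s2.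
Proof.
rewrite /chi size_cat oddD flips_along_cat !andb_addr.
by rewrite -!addbA; congr (_ (+) _); rewrite addbCA.
Qed.

Definition realizes w (p : {perm Q}) :=
  exists2 s, loop w s & path_perm (outs w s) = p.
Definition full_last w := forall p, fixes (last None w) p -> realizes w p.
Definition odd_loops w := forall i j, i || j ->
  exists2 s, loop w s & chi i j w s.
Definition reduced w := sorted (fun x y => x != y) w.

Lemma reduced_rcons w x :
  reduced (rcons w x) = reduced w && (nilp w || (last None w != x)).
Proof. by case: w => //= y w; rewrite rcons_path. Qed.

Lemma reduced_rev w : reduced (rev w) = reduced w.
Proof.
by rewrite /reduced rev_sorted; apply: eq_sorted => x y /=; rewrite eq_sym.
Qed.

(** * The dual action on states *)
Variables (a b : Q).
Hypothesis ab : a != b.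
Hypothesis fla : fl a = false.
Hypothesis flb : fl b = false.
Hypothesis pi_tau : pi true = tperm a b * pi false.
Hypothesis pi_b : pi false b = b.
Hypothesis pi_orbit : forall q, q != b -> exists i, q = iter i (pi false) a.
Hypothesis cardQ_gt3 : 3 < #|Q|.
Hypothesis cardQ_even : ~~ odd #|Q|.

(** Under the input 0 the states other than [b] form one cycle, enumerated from
[a] on by [orb]. *)
Let period := #|Q|.-1.
Let orb i := iter i (pi false) a.

Lemma porbit_a : porbit (pi false) a =i predC1 b.
Proof.
move=> q; rewrite !inE; apply/porbitP/idP => [[i ->]|/pi_orbit[i ->]].
  rewrite permX; apply: contra ab => /eqP h; apply/eqP.
  apply: (@perm_inj _ (pi false ^+ i)); rewrite !permX h.
  by elim: (i) => //= k <-.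
by exists i; rewrite permX.
Qed.

Lemma card_porbit_a : #|porbit (pi false) a| = period.
Proof. by rewrite (eq_card porbit_a) cardC1. Qed.

Lemma orb_inj i j : i < period -> j < period -> orb i = orb j -> i = j.
Proof.
have := uniq_traject_porbit (pi false) a; rewrite card_porbit_a => U hi hj e.
apply/eqP; rewrite -(nth_uniq a _ _ U) ?size_traject // !nth_traject //.
exact/eqP.
Qed.

Lemma orb_neqb i : orb i != b.
Proof.
have : orb i \in porbit (pi false) a by rewrite -[orb i]permX mem_porbit.
by rewrite porbit_a.
Qed.

Lemma orb_neqa i : 0 < i < period -> orb i != a.
Proof.
move=> /andP[i0 hi]; apply: contraTneq i0 => h.
by rewrite (@orb_inj i 0) //; apply: leq_ltn_trans hi.
Qed.

Lemma orb_period : orb period = a.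
Proof. by rewrite /orb -card_porbit_a iter_porbit. Qed.

Lemma orbP q : q != b -> exists2 i, i < period & q = orb i.
Proof.
rewrite -[_ != _]/(q \in predC1 b) -porbit_a porbit_traject.
by rewrite card_porbit_a => /trajectP[i hi ->]; exists i.
Qed.

Lemma pi_period : pi false ^+ period = 1.
Proof.
apply/permP => q; rewrite perm1 permX.
have [->|/pi_orbit[i ->]] := eqVneq q b.
  by elim: period => //= k ->.
by rewrite -iterD addnC iterD -/(orb period) orb_period.
Qed.

Lemma period_odd : odd period.
Proof.
by rewrite /period; case: #|Q| cardQ_gt3 cardQ_even => //= k _; rewrite negbK.
Qed.

(** A cycle of odd length is even; here, a permutation with an odd power equal to
the identity. *)
Lemma pi_even : odd_perm (pi false) = false.
Proof.
have oddX (p : {perm Q}) k : odd_perm (p ^+ k) = odd k && odd_perm p.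
  elim: k => [|k IH]; first by rewrite odd_perm1.
  by rewrite expgS odd_permM IH /=; case: (odd k); case: (odd_perm p).
by have := oddX (pi false) period; rewrite pi_period odd_perm1 period_odd.
Qed.

Lemma pi_negb t : pi (~~ t) = tperm a b * pi t.
Proof. by case: t; rewrite /= pi_tau // mulgA tperm2 mul1g. Qed.

Lemma pi_avoid q : q != a -> q != b -> forall t t', pi t q = pi t' q.
Proof.
move=> qa qb t t'.
suff e u : pi u q = pi false q by rewrite (e t) (e t').
by case: u => //; rewrite pi_tau permM tpermD // eq_sym.
Qed.

(** Neither [a] nor [b] flips, and the inputs 0 and 1 act differently on these two
only. This makes every letter an involution ([outsK]) and makes it act in the
same way when words are reversed ([sec_rev]). *)
Lemma omap_flip t x : omap (pi (t (+) flips x)) x = omap (pi t) x.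
Proof.
case: x => //= q; have [fq|] := boolP (fl q); last by rewrite addbF.
congr Some; apply: pi_avoid; first by apply: contraTneq fq => ->; rewrite fla.
by apply: contraTneq fq => ->; rewrite flb.
Qed.

Lemma outsK x : involutive (outs [:: x]).
Proof.
move=> s; elim: s x => //= t s IH x; rewrite !addbF addbK; congr (_ :: _).
by rewrite omap_flip IH.
Qed.

Lemma path_perm_outs x s :
  omap (path_perm (outs [:: x] s)) x = omap (path_perm s) x.
Proof.
elim: s x => //= t s IH [q|] //=; have [e] := omap_flip t (Some q).
by rewrite !permM !addbF e; apply: (IH (Some _)).
Qed.

Lemma flips_along_outs x s :
  flips_along [:: x] (outs [:: x] s) = flips_along [:: x] s.
Proof.
by elim: s x => //= t s IH x; rewrite !addbF omap_flip IH.
Qed.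

(** The input 1 induces an odd permutation and the input 0 an even one, so that
both signs count ones modulo 2, and ones appear or disappear where [w] flips.
*)
Lemma odd_path_perm_outs w s :
  odd_perm (path_perm (outs w s)) = odd_perm (path_perm s) (+) flips_along w s.
Proof.
have pi_odd t : odd_perm (pi t) = t.
  by case: t; rewrite ?pi_even // pi_tau odd_permM odd_tperm ab pi_even.
elim: s w => [|t s IH] w /=; first by rewrite addbF.
by rewrite !odd_permM IH !pi_odd addbACA.
Qed.

Lemma last_sec w s :
  last None (sec w s) = omap (path_perm (outs w s)) (last None w).
Proof.
case/lastP: w => [|w x]; first by rewrite sec_nil.
by rewrite sec_rcons !last_rcons -cats1 outs_wcat path_perm_outs.
Qed.

Lemma loop_fixes w s : loop w s -> fixes (last None w) (path_perm (outs w s)).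
Proof. by move=> h; rewrite /fixes -last_sec h. Qed.

Lemma loop_fixes_head w s : loop w s -> fixes (head None w) (path_perm s).
Proof.
by case: w => [|x w] //; rewrite /loop sec_cons => -[].
Qed.

Lemma parity_rev w : parity (rev w) = parity w.
Proof.
by elim: w => //= x w IH; rewrite rev_cons -cats1 parity_cat IH /= addbF addbC.
Qed.

Lemma step_rev t w : step (t (+) parity w) (rev w) = rev (step t w).
Proof.
elim: w t => //= x w IH t; rewrite rev_cons -cats1 step_cat addbA IH.
by rewrite parity_rev addbK /= omap_flip rev_cons cats1.
Qed.

Lemma sec_rev w s : sec (rev w) (outs w s) = rev (sec w s).
Proof. by elim: s w => //= t s IH w; rewrite step_rev IH. Qed.

(** A word of involutions, reversed, is the inverse word: it reads the output of
[w] and puts out the input. The two ends of [w] thus play symmetric roles. *)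
Lemma full_last_head w p : full_last (rev w) -> fixes (head None w) p ->
  exists2 s, loop w s & path_perm s = p.
Proof.
move=> h fp; have [|s Ls <-] := h p.
  by case: (w) fp => //= x v; rewrite rev_cons last_rcons.
by exists (outs (rev w) s) => //; rewrite /loop -{1}(revK w) sec_rev Ls revK.
Qed.

Lemma chi_back i j w s : path_perm s = 1 -> path_perm (outs w s) = 1 ->
  ~~ odd (size s) -> chi i j w s = false.
Proof.
move=> p1 p2 od; rewrite /chi (negbTE od) andbF /=.
have := odd_path_perm_outs w s; rewrite p1 p2 odd_perm1 /= => <-.
by rewrite andbF.
Qed.

(** The path [g] and its return contribute nothing, because [path_return] provides
a return with even total length and even total flip count. *)
Lemma chi_path i j w g :
  (exists2 s, loop (sec w g) s & chi i j (sec w g) s) ->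
  exists2 s, loop w s & chi i j w s.
Proof.
move=> [s Ls hs]; have [r [Lr p1 p2 od]] := path_return w g.
have := chi_back i j p1 p2 od; rewrite chi_cat => e.
rewrite /loop sec_cat in Lr.
exists (g ++ s ++ r); first by rewrite /loop !sec_cat Ls.
by rewrite !chi_cat Ls hs addbCA e.
Qed.

Lemma realizes1 w : realizes w 1.
Proof. by exists [::]. Qed.

Lemma realizesM w p1 p2 :
  realizes w p1 -> realizes w p2 -> realizes w (p1 * p2).
Proof.
move=> [s1 L1 <-] [s2 L2 <-]; exists (s1 ++ s2); first exact: loop_cat.
by rewrite outs_cat path_perm_cat L1.
Qed.

Lemma realizes_path w g p :
  realizes (sec w g) (p ^ path_perm (outs w g)) -> realizes w p.
Proof.
move=> [s Ls hs]; have [r [Lr _ p2 _]] := path_return w g.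
rewrite /loop sec_cat in Lr; rewrite outs_cat path_perm_cat in p2.
exists (g ++ s ++ r); first by rewrite /loop !sec_cat Ls.
rewrite !outs_cat !path_perm_cat Ls hs /conjg !mulgA mulgV mul1g.
by rewrite -mulgA p2 mulg1.
Qed.

Lemma full_last_path w g : full_last (sec w g) -> full_last w.
Proof.
move=> h p fp; apply: (@realizes_path _ g); apply: h.
rewrite last_sec; move: fp; rewrite /fixes.
by case: (last None w) => //= q [fq]; rewrite permJ fq.
Qed.

(** * Transpositions and orbits *)
Definition avoiding w := all (fun x => (x != Some a) && (x != Some b)) w.

(** The word [w] has the same section at the inputs 0 and 1. Reading 1 in place of
the initial 0 of a loop that acts trivially at both ends leaves the
transposition of [a] and [b] at both ends. *)
Lemma tau_loop w : avoiding w -> exists s,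
  [/\ loop w s, path_perm s = tperm a b & path_perm (outs w s) = tperm a b].
Proof.
move=> av; have st : step true w = step false w.
  elim: w av (true) (false) => //= -[q|] w IH /andP[/= hx /IH e] t t'.
    case/andP: hx => qa qb.
    by rewrite (e _ (t' (+) fl q)) (pi_avoid qa qb t t').
  by rewrite (e _ (~~ t')) addbT.
have [r [/= Lr p1 p2 _]] := path_return w [:: false].
exists (true :: r); split; first by rewrite /loop /= st.
  by rewrite /= pi_tau -mulgA p1 mulg1.
rewrite /= st pi_negb; move: p2; rewrite /= => p2.
by rewrite -mulgA p2 mulg1.
Qed.

(** Transitivity of the dual action on reduced words with the letters [None] in
prescribed places, one letter at a time: a loop at the prefix adjusts the last
letter. *)
Lemma eq_pattern_path w v : reduced w -> reduced v ->
  map isSome w = map isSome v ->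
  (forall u, reduced u -> size u < size w -> full_last u) ->
  exists g, sec w g = v.
Proof.
elim/last_ind: w v => [|w x IH] v; first by case: v => // _ _ _ _; exists [::].
case/lastP: v => [|v y]; first by rewrite map_rcons; case: w {IH}.
rewrite !reduced_rcons !map_rcons => /andP[rw hx] /andP[rv hy].
move=> /rcons_inj[ewv exy] HS.
have szwv : size w = size v by rewrite -(size_map isSome w) ewv size_map.
have [|g wg] := IH v rw rv ewv.
  by move=> u ru su; apply: HS => //; rewrite size_rcons leqW.
case: x y exy hx hy {HS}(HS v rv) => [q|] [q'|] // _ hx hy.
  rewrite size_rcons szwv => /(_ (leqnn _)) Sv.
  set u := path_perm (outs w g).
  have hl : (nilp v || (last None v != Some (u q))).
    move: hx; rewrite /nilp szwv; case: (_ == 0) => //=.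
    rewrite -wg last_sec -/u; case: (last None w) => //= l.
    by apply: contra => /eqP[/perm_inj->].
  have [|s Ls hs] := Sv (tperm (u q) q').
    move: hl hy; case/lastP: (v) => [|v' z] //=.
    rewrite /nilp size_rcons last_rcons /= => h1 h2.
    by apply: fixes_tperm; rewrite eq_sym.
  by exists (g ++ s); rewrite sec_cat !sec_rcons wg Ls hs /= -/u tpermL.
by move=> _; exists g; rewrite sec_rcons wg.
Qed.

Lemma exists_avoiding w : reduced w ->
  exists2 v, reduced v & avoiding v /\ map isSome w = map isSome v.
Proof.
move=> rw.
have [c [d [/= cd ca cb da db]]] : exists c d,
    [/\ c != d, c != a, c != b, d != a & d != b].
  have : 1 < #|[predC [:: a; b]]|.
    by rewrite -(leq_add2l #|[:: a; b]|) cardC; apply: leq_trans cardQ_gt3;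
      rewrite addn2 !ltnS; apply: card_size.
  case/card_gt1P=> c [d []]; rewrite !inE !negb_or => /andP[? ?] /andP[? ?] ?.
  by exists c, d.
(* Alternating between two states keeps neighbours distinct. *)
pose fix alt (i : bool) w := if w is x :: w' then
  omap (fun=> if i then c else d) x :: alt (~~ i) w' else [::].
exists (alt true w); last first.
  split; elim: w {rw} true => //= x w IH i; last by rewrite -IH; case: x.
  rewrite IH andbT; case: x => //= _.
  by case: i; apply/andP; split.
elim: w rw true => //= x [|y w] //= IH /andP[xy rw] i.
rewrite /reduced /= in IH *; rewrite -/(sorted _ (_ :: _)).
apply/andP; split; last exact: (IH rw (~~ i)).
case: x y xy {IH rw} => [p|] [q|] //= _; case: i => //=.
by rewrite eq_sym.
Qed.

Lemma full_last_None w : full_last w -> full_last (None :: w).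
Proof.
move=> h p fp; have [|s Ls hs] := h p; first by case: w fp {h}.
exists (outs [:: None] s); last by rewrite -cat1s outs_wcat outsK.
by rewrite /loop sec_cons outsK Ls.
Qed.

(** The joint action of the loops at [w] on the letters before and after [w]
satisfies the hypotheses of [goursat_signs]; the pair of transpositions comes
from a word in the same orbit that avoids [a] and [b], by conjugation. *)
Lemma full_last_cons q w : 0 < size w -> reduced (Some q :: w) ->
  (forall v, reduced v -> size v <= size w -> full_last v) ->
  (exists2 s, loop w s & flips_along w s) -> full_last (Some q :: w).
Proof.
move=> w0 rqw HS [sF LF hF].
have rw : reduced w by move: rqw; rewrite /reduced /= => /path_sorted.
pose P p p' := exists s,
  [/\ loop w s, path_perm s = p & path_perm (outs w s) = p'].
have PM (s t s' t' : {perm Q}) : P s s' -> P t t' -> P (s * t) (s' * t').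
  move=> [u [Lu <- <-]] [v [Lv <- <-]]; exists (u ++ v).
  by rewrite outs_cat !path_perm_cat Lu; split=> //; apply: loop_cat.
have Pw : forall p' : {perm Q}, fixes (last None w) p' -> P 1 p'.
  have [v rv [av ev]] := exists_avoiding rw.
  have [g gv] : exists g, sec w g = v.
    by apply: eq_pattern_path => // u ru su; apply: HS => //; apply: ltnW.
  have [s [Ls s1 s2]] := tau_loop av.
  have [r [Lr r1 r2 _]] := path_return w g.
  rewrite /loop sec_cat gv in Lr; rewrite outs_cat !path_perm_cat gv in r1 r2.
  set u1 := path_perm g in r1; set u2 := path_perm (outs w g) in r2.
  have e1 : path_perm r = u1^-1 by apply: (mulgI u1); rewrite mulgV.
  have e2 : path_perm (outs v r) = u2^-1.
    by apply: (mulgI u2); rewrite mulgV.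
  apply: (@goursat_signs _ (head None w) (last None w) P _ _ _ _ _
      (u1^-1 a) (u1^-1 b) (u2^-1 a) (u2^-1 b)).
  - by exists [::]; rewrite /loop; split.
  - exact: PM.
  - move=> _ _ [t [Lt <- <-]]; split; first exact: loop_fixes_head.
    exact: loop_fixes.
  - move=> p fp; have [|t Lt <-] := full_last_head _ fp.
      by apply: HS; rewrite ?reduced_rev ?size_rev.
    by exists (path_perm (outs w t)), t.
  - move=> p fp; have [|t Lt <-] := HS w rw _ _ fp; first exact: leqnn.
    by exists (path_perm t), t.
  - by rewrite (inj_eq perm_inj).
  - by rewrite (inj_eq perm_inj).
  - exists (g ++ s ++ r); split; first by rewrite /loop !sec_cat gv Ls.
      rewrite !path_perm_cat s1 e1 -tpermJ /conjg invgK -/u1; by rewrite mulgA.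
    rewrite !outs_cat !path_perm_cat gv Ls s2 e2 -tpermJ /conjg invgK -/u2.
    by rewrite mulgA.
  exists (path_perm sF), (path_perm (outs w sF)); split; first by exists sF.
  by rewrite odd_path_perm_outs hF addbT; case: (odd_perm _).
move=> p fp; have [|s [Ls s1 s2]] := Pw p; first by case: (w) w0 fp.
(* The prefix q, an involution, has to put out the loop s. *)
exists (outs [:: Some q] s); last by rewrite -cat1s outs_wcat outsK.
by rewrite /loop sec_cons outsK Ls path_perm_outs s1 /= perm1.
Qed.

Lemma realizes_tperm_trans w (x y z : Q) : x != y -> y != z -> x != z ->
  realizes w (tperm x y) -> realizes w (tperm y z) -> realizes w (tperm x z).
Proof.
move=> xy yz xz hxy hyz.
suff -> : tperm x z = tperm y z * tperm x y * tperm y z.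
  by do 2?apply: realizesM.
rewrite -{1}(tpermV y z) -mulgA -[RHS]/(_ ^ _) tpermJ tpermL.
by rewrite tpermD // eq_sym.
Qed.

Lemma full_last_of_star w (u : Q) : Some u != last None w ->
  (forall y : Q, Some y != last None w -> y != u -> realizes w (tperm u y)) ->
  full_last w.
Proof.
move=> ou hu; apply: fixing_perm_ind; first exact: realizes1.
move=> s x y ox oy xy _ hs; apply: realizesM => //.
have [->|xu] := eqVneq x u.
  by have [<-|yu] := eqVneq y u; [rewrite tperm1; apply: realizes1|apply: hu].
have [->|yu] := eqVneq y u; first by rewrite tpermC; apply: hu.
apply: (@realizes_tperm_trans _ _ u) => //; rewrite 1?eq_sym //.
  by rewrite tpermC; apply: hu.
exact: hu.
Qed.

(** Conjugating the transposition of [a] and [b] by the powers of [pi false] gives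
all transpositions that move [b]. *)
Lemma full_last_nil : full_last [::].
Proof.
have [t [_ _ ht]] := @tau_loop [::] isT.
have hab : realizes [::] (tperm a b) by exists t; rewrite // /loop sec_nil.
apply: (@full_last_of_star _ b) => // q _ /orbP[i _ ->].
have [r [Lr p1 _ _]] := path_return [::] (nseq i false).
rewrite tpermC; apply: (@realizes_path _ r); rewrite sec_nil outs_nil.
have e : path_perm (nseq i false) = pi false ^+ i.
  by elim: i {r Lr p1} => //= i ->; rewrite expgS.
rewrite path_perm_cat e in p1.
have -> : path_perm r = (pi false ^+ i)^-1.
  by apply: (mulgI (pi false ^+ i)); rewrite mulgV.
have eb : (pi false ^+ i) b = b by rewrite permX; elim: (i) => //= k ->.
rewrite tpermJ /orb -permX permK; suff -> : (pi false ^+ i)^-1 b = b by [].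
by rewrite -{1}eb permK.
Qed.

Lemma period_gt2 : 2 < period.
Proof. by rewrite /period -ltnS prednK // (ltn_trans _ cardQ_gt3). Qed.

(** Downward induction on [i]. The one-step path from [orb i] to [orb i.+1] pulls
the transpositions of [a] with [orb j.+1] and with [b] back to transpositions of
[z], the last state of the cycle, with [orb j] and with [a] or [b]; together
with the transposition of [a] and [b] these connect [a] to all [orb j]. *)
Lemma realizes_letter_orb i : 0 < i < period -> forall y : Q,
  y = b \/ (exists2 j, i < j < period & y = orb j) ->
  realizes [:: Some (orb i)] (tperm a y).
Proof.
move=> /andP[]; have [k] := ubnP (period - i); elim: k i => // k IH i hk i0 hi.
have av n : 0 < n < period -> avoiding [:: Some (orb n)].
  move=> hn; rewrite /avoiding /= andbT (orb_neqb n : Some _ != Some _) andbT.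
  exact: orb_neqa.
have hab : realizes [:: Some (orb i)] (tperm a b).
  have [|s [Ls _ hs]] := @tau_loop [:: Some (orb i)]; last by exists s.
  by apply: av; rewrite i0.
move=> y [->//|[j /andP[ij hj] ->]].
have iSp : i.+1 < period by apply: leq_ltn_trans hj.
have {IH} IH z : z = b \/ (exists2 j, i.+1 < j < period & z = orb j) ->
    realizes [:: Some (orb i.+1)] (tperm a z).
  apply: IH => //; rewrite -ltnS; apply: leq_trans hk.
  by rewrite ltnS ltn_sub2l.
pose g := pi (fl (orb i)).
have pull p : realizes [:: Some (orb i.+1)] (p ^ g) ->
    realizes [:: Some (orb i)] p.
  move=> h; apply: (@realizes_path _ [:: false]) => /=.
  by rewrite addbF mulg1.
pose z := orb period.-1.
have per0 : 0 < period by apply: ltn_trans period_gt2.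
have hz : 0 < period.-1 < period.
  by rewrite -ltnS prednK // leqnn (ltn_trans _ period_gt2).
have za : z != a by apply: orb_neqa.
have zb : z != b by apply: orb_neqb.
have g_orb n : 0 < n < period -> g (orb n) = orb n.+1.
  move=> hn; rewrite /g (pi_avoid _ _ _ false) //.
    exact: orb_neqa.
  exact: orb_neqb.
have gz : g z = a by rewrite /z g_orb // prednK // orb_period.
have haz : realizes [:: Some (orb i)] (tperm a z).
  (* Which of a and b goes to b depends on whether orb i flips. *)
  have [gb|ga] : g b = b \/ g a = b.
    rewrite /g; case: (fl _); [right|by left].
    by rewrite pi_tau permM tpermL.
    have hbz : realizes [:: Some (orb i)] (tperm b z).
      by apply: pull; rewrite tpermJ gb gz tpermC; apply: IH; left.
    by apply: (@realizes_tperm_trans _ _ b); rewrite // eq_sym.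
  by apply: pull; rewrite tpermJ ga gz tpermC; apply: IH; left.
have [->//|jp] := eqVneq j period.-1.
have hj1 : j.+1 < period.
  by rewrite -(prednK per0) ltnS ltn_neqAle jp -ltnS prednK.
have j0 : 0 < j by apply: leq_ltn_trans ij.
have zj : z != orb j.
  apply: contraNneq jp => e; rewrite (orb_inj hj _ (esym e)) //.
  by case/andP: hz.
apply: (@realizes_tperm_trans _ _ z); rewrite // 1?eq_sym //.
  by apply: orb_neqa; rewrite j0.
apply: pull; rewrite tpermJ gz g_orb ?j0 //; apply: IH; right.
by exists j.+1 => //; rewrite hj1 andbT ltnS.
Qed.

Lemma letter_path q q' : exists g, sec [:: Some q] g = [:: Some q'].
Proof.
by apply: eq_pattern_path => // -[|//] _ _; apply: full_last_nil.
Qed.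

Lemma full_last_letter q : full_last [:: Some q].
Proof.
have [g hg] := letter_path q (orb 1).
have p1 : 0 < 1 < period by rewrite (ltn_trans _ period_gt2).
apply: (@full_last_path _ g); rewrite hg.
apply: (@full_last_of_star _ a) => /= [|x].
  by rewrite -[_ != _]/(a != orb 1) eq_sym; apply: orb_neqa.
move=> ox xa; apply: (realizes_letter_orb p1).
have [|/orbP[j hj xj]] := eqVneq x b; [by left|right; exists j => //].
rewrite hj andbT; case: j xj {hj} => [|[|//]] e; first by rewrite e eqxx in xa.
by rewrite e eqxx in ox.
Qed.

(** * Loops with prescribed parities *)
Hypothesis odd_fl : odd #|fl|.
Hypothesis nonflip : exists q, [/\ q != a, q != b & ~~ fl q].

Lemma sum_flips_along_letters s :
  \big[addb/false]_(q : Q) flips_along [:: Some q] s = odd (size s).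
Proof.
elim: s => [|t s IH] /=; first by rewrite big1.
rewrite big_split /= -IH -addTb; congr (_ (+) _).
  under eq_bigr do rewrite addbF.
  by rewrite big_addb_card.
by rewrite [RHS](reindex_inj (@perm_inj _ (pi t))).
Qed.

Lemma chi_rep i j w (q : Q) s k : loop w s ->
  chi i j (rcons w (Some q)) (rep k s) =
  \big[addb/false]_(0 <= m < k)
     chi i j (rcons w (Some ((path_perm (outs w s) ^+ m) q))) s.
Proof.
move=> Ls; elim: k q => [|k IH] q; first by rewrite big_nil /chi !andbF.
rewrite big_nat_recl // expg0 perm1 /= chi_cat sec_rcons Ls IH; congr (_ (+) _).
by apply: eq_bigr => m _; rewrite expgS permM.
Qed.

(** The loop [s] at [w] permutes the words [rcons w q'] as it permutes the letters
[q']. An odd sum over all letters is odd on some cycle, and running through that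
cycle is a loop at one of these words; a loop at [w] transports it to the
letter [q]. *)
Lemma chi_of_sum i j w (q : Q) s :
  full_last w -> loop w s -> Some q != last None w ->
  \big[addb/false]_(q' | Some q' != last None w)
     chi i j (rcons w (Some q')) s ->
  exists2 s', loop (rcons w (Some q)) s' & chi i j (rcons w (Some q)) s'.
Proof.
move=> Sw Ls oq; rewrite big_mkcond => /(odd_cycle (path_perm (outs w s)))[q1].
set p := path_perm (outs w s) => h.
have fp : fixes (last None w) p by apply: loop_fixes.
have fpm m : fixes (last None w) (p ^+ m).
  by elim: m => [|m IH]; [apply: fixes1|rewrite expgS; apply: fixesM].
have [oq1|] := boolP (Some q1 != last None w); last first.
  rewrite negbK => /eqP lq; move: h; rewrite big1 // => m _.
  by have := fpm m; rewrite /fixes -lq /= => -[->]; rewrite eqxx.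
have [g Lg hg] := Sw _ (fixes_tperm oq oq1).
apply: (@chi_path _ _ _ g); rewrite sec_rcons Lg hg /= tpermL.
exists (rep #|porbit p q1| s).
  rewrite /loop sec_rcons loop_rep // outs_rep // path_perm_rep -/p /= permX.
  by rewrite iter_porbit.
rewrite chi_rep // -/p; apply: etrans h; apply: eq_bigr => m _.
by rewrite fixes_neq.
Qed.

Lemma chi_wcat_rcons i j w x s :
  chi i j (rcons w x) s = chi i j w s (+) (j && flips_along [:: x] (outs w s)).
Proof. by rewrite /chi -cats1 flips_along_wcat andb_addr addbA. Qed.

(** The contribution of [w] itself occurs an even number of times, and on every
input bit an odd number of states flip. *)
Lemma chi_sum i w s :
  \big[addb/false]_(q : Q) chi i true (rcons w (Some q)) s = odd (size s).
Proof.
under eq_bigr do rewrite chi_wcat_rcons.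
rewrite big_split /= sum_flips_along_letters size_outs.
rewrite big_const.
suff -> : iter #|Q| (addb (chi i true w s)) false = false by [].
have {1}-> : #|Q| = (#|Q|./2).*2 by rewrite even_halfK.
by elim: (_./2) => //= k ->; rewrite addbF addbb.
Qed.

(** Against [chi_sum] the term of the letter [l] is missing. Two adjacent letters
[l] cancel, so that this term is the parity for [w]. *)
Lemma chi_sum_but_last i w l s :
  \big[addb/false]_(q : Q | Some q != Some l)
     chi i true (rcons (rcons w (Some l)) (Some q)) s = chi (~~ i) true w s.
Proof.
have := chi_sum i (rcons w (Some l)) s; rewrite (bigD1 l) //=.
rewrite (chi_wcat_rcons _ _ (rcons _ _)) chi_wcat_rcons.
rewrite -(cats1 w) outs_wcat flips_along_outs /= addbK.
set X := bigop _ _ _; move=> h.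
have -> : X = odd (size s) (+) chi i true w s by rewrite -h addbAC addbb.
by rewrite /chi; case: (i); case: (odd _); case: (flips_along w s).
Qed.

(** A homomorphism to the group of order two that vanishes on the stabilizers of
all letters vanishes altogether, because the stabilizers of two points generate
the symmetric group of at least three points. *)
Lemma chi_restrict i j w (q : Q) : full_last w -> Some q != last None w ->
  (exists2 s, loop w s & chi i j w s) ->
  exists2 s, loop (rcons w (Some q)) s & chi i j w s.
Proof.
move=> Sw oq [s Ls hs]; set q' := path_perm (outs w s) q.
have oq' : Some q' != last None w by apply: fixes_neq => //; apply: loop_fixes.
have chiL s1 s2 : loop w s1 ->
    chi i j w (s1 ++ s2) = chi i j w s1 (+) chi i j w s2.
  by move=> L1; rewrite chi_cat L1.
have [qq'|qq'] := eqVneq q' q.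
  by exists s => //; rewrite /loop sec_rcons Ls /= -/q' qq'.
have [g Lg hg] := Sw _ (fixes_tperm oq oq').
(* The transposition g sends the image q' back to q; if g is even, s followed by
   g is odd and fixes q. *)
have [cg|cg] := boolP (chi i j w g); last first.
  exists (s ++ g); last by rewrite chiL // hs (negbTE cg).
  by rewrite /loop sec_cat !sec_rcons Ls Lg hg /= -/q' tpermR.
(* If g is odd, then it is an odd loop fixing a third letter q2; conjugating
   exchanges q2 for q. *)
have [q2] : exists q2, [&& q2 != q, q2 != q' & Some q2 != last None w].
  have : #|[:: q; q'; odflt q (last None w)]| < #|Q|.
    by apply: leq_ltn_trans cardQ_gt3; apply: card_size.
  rewrite ltnNge; move=> h; apply/existsP; apply: contraR h => /existsPn h.
  apply/subset_leq_card/fintype.subsetP => x _; move: (h x).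
  rewrite !inE; case: (x == q) => //=; case: (x == q') => //=.
  by rewrite negbK => /eqP <- /=; rewrite eqxx.
case/and3P=> q2q q2q' oq2; have [h Lh hh] := Sw _ (fixes_tperm oq oq2).
exists (h ++ g ++ h).
  rewrite /loop !sec_cat !sec_rcons Lh Lg Lh hh hg /= tpermL.
  by rewrite (tpermD (z := q2)) ?tpermR // eq_sym.
by rewrite !chiL // cg; case: (chi i j w h).
Qed.

Lemma path_perm_nseq k : path_perm (nseq k false) = pi false ^+ k.
Proof. by elim: k => //= k ->; rewrite expgS. Qed.

Lemma loop_letter_period q : loop [:: Some q] (nseq period false).
Proof. by rewrite /loop sec_letter path_perm_nseq pi_period /= perm1. Qed.

(** Over a full turn the letter meets every state except [b] once. *)
Lemma flips_along_a_period : flips_along [:: Some a] (nseq period false).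
Proof.
have E k n : flips_along [:: Some (orb n)] (nseq k false) =
    \big[addb/false]_(0 <= m < k) fl (orb (n + m)).
  elim: k n => [|k IH] n; first by rewrite big_nil.
  rewrite big_nat_recl // addn0 /= addbF (IH n.+1); congr (_ (+) _).
  by apply: eq_bigr => m _; rewrite addSnnS.
rewrite (E period 0).
rewrite -[X in is_true X]/(\big[addb/false]_(0 <= m < period) fl (orb m)).
rewrite -(big_traject (pi false) a period fl).
have U := uniq_traject_porbit (pi false) a; rewrite card_porbit_a in U.
rewrite (big_uniq _ U) /=.
have := odd_fl; rewrite -big_addb_card (bigD1 b) //= flb addFb.
rewrite (eq_bigl (mem (traject (pi false) a period))) // => q.
by rewrite -[q != b]/(q \in predC1 b) -porbit_a porbit_traject card_porbit_a.
Qed.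

Lemma flips_along_orb_period n :
  flips_along [:: Some (orb n)] (nseq period false).
Proof.
have : flips_along [:: Some a] (nseq n false ++ nseq period false) =
       flips_along [:: Some a] (nseq period false ++ nseq n false).
  by rewrite -!nseqD addnC.
rewrite !flips_along_cat loop_letter_period sec_letter path_perm_nseq /= permX.
rewrite flips_along_a_period.
by rewrite addbC => /addIb.
Qed.

(** As long as the letter stays away from [a] and [b], the input bits are
irrelevant. *)
Lemma orb_track m u : 0 < m -> m + size u <= period ->
  path_perm u (orb m) = orb (m + size u) /\
  flips_along [:: Some (orb m)] u =
  flips_along [:: Some (orb m)] (nseq (size u) false).
Proof.
elim: u m => [|t u IH] m m0 /=; first by rewrite perm1 addn0.
rewrite addnS => hm; have e : pi t (orb m) = orb m.+1.
  have hm' : 0 < m < period by rewrite m0 (leq_trans _ hm) // ltnS leq_addr.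
  by rewrite (pi_avoid _ _ _ false) //; [apply: orb_neqa|apply: orb_neqb].
rewrite permM e -[pi false (orb m)]/(orb m.+1).
have [||-> ->] := IH m.+1; rewrite ?addSn //.
Qed.

(** As [q] does not flip, the second letter meets the input 0 whenever it is at
[a], that is at the start, so that both letters return after a full turn. The
length of the turn is odd, and its flip count is even, odd for each letter. *)
Lemma nonflip_pair_loop q : q != a -> q != b -> ~~ fl q ->
  exists2 s, loop [:: Some q; Some a] s & chi true true [:: Some q; Some a] s.
Proof.
move=> qa qb fq; have p0 : 0 < period by apply: ltn_trans period_gt2.
have [u su eu] : exists2 u, size u = period.-1 &
    outs [:: Some q] (nseq period false) = false :: u.
  rewrite -(prednK p0) /= (negbTE fq) /=.
  by eexists; last reflexivity; rewrite size_outs size_nseq.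
have [|hp hflips] := @orb_track 1 u isT; first by rewrite su add1n prednK.
exists (nseq period false).
  rewrite /loop sec_cons path_perm_nseq pi_period /= perm1 eu sec_letter /= permM.
  by rewrite -[pi false a]/(orb 1) hp su add1n prednK // orb_period.
have [n _ qn] := orbP qb.
rewrite /chi size_nseq period_odd -cat1s flips_along_wcat {1}qn.
rewrite flips_along_orb_period eu /=.
rewrite -[pi false a]/(orb 1) hflips su.
by have := flips_along_a_period; rewrite -{1}(prednK p0) /= => ->.
Qed.

(** The letter [b] has a flip-free loop of length one, and [a] has the full turn of
[pi false], whose flip count is odd. *)
Lemma odd_loops_letter q : odd_loops [:: Some q].
Proof.
case=> [] j ij.
  have [g hg] := letter_path q b; apply: (@chi_path _ _ _ g); rewrite hg.
  by exists [:: false]; rewrite /loop /chi /= ?pi_b // flb andbF.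
case: j ij => // _; have [g hg] := letter_path q a.
apply: (@chi_path _ _ _ g); rewrite hg; exists (nseq period false).
  exact: loop_letter_period.
by rewrite /chi /= flips_along_a_period.
Qed.

(** A letter [None] adds the length of the loop to its flip count. *)
Lemma odd_loops_step_None w : odd_loops w -> odd_loops (rcons w None).
Proof.
move=> h i j ij.
have [|s Ls hs] := h (i (+) j) j; first by case: i j ij => [] [].
exists s; first by rewrite /loop sec_rcons Ls.
rewrite chi_wcat_rcons flips_along_None size_outs; move: hs; rewrite /chi.
by case: i j {ij} => [] [] /=; case: (odd _); case: (flips_along w s).
Qed.

Lemma odd_loops_step_after_None w q :
  full_last (rcons w None) -> odd_loops (rcons w None) ->
  odd_loops (rcons (rcons w None) (Some q)).
Proof.
move=> Sw Iw i [|] ij.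
  have [|s Ls hs] := Iw true false; first by [].
  apply: (chi_of_sum Sw Ls); first by rewrite last_rcons.
  rewrite (eq_bigl xpredT) => [|q']; last by rewrite last_rcons.
  by rewrite chi_sum; move: hs; rewrite /chi addbF.
have [|s Ls hs] := @chi_restrict true false _ q Sw _ (Iw true false isT).
  by rewrite last_rcons.
by exists s => //; move: ij hs; rewrite orbF /chi => ->.
Qed.

Lemma odd_loops_step_after_Some w l q : Some q != Some l ->
  full_last (rcons w (Some l)) -> odd_loops (rcons w (Some l)) ->
  (forall i, exists2 s, loop (rcons w (Some l)) s & chi i true w s) ->
  odd_loops (rcons (rcons w (Some l)) (Some q)).
Proof.
move=> ql Sw Iw Iw' i [|] ij.
  have [s Ls hs] := Iw' (~~ i).
  apply: (chi_of_sum Sw Ls); first by rewrite last_rcons.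
  by rewrite last_rcons chi_sum_but_last.
have [|s Ls hs] := @chi_restrict true false _ q Sw _ (Iw true false isT).
  by rewrite last_rcons.
by exists s => //; move: ij hs; rewrite orbF /chi => ->.
Qed.

(** The combination with both coefficients 1 is not accessible by summation here,
as the word before the last two letters is empty; it is odd on the loop of
[nonflip_pair_loop]. *)
Lemma odd_loops_pair l q : l != q -> odd_loops [:: Some l; Some q].
Proof.
move=> lq [] [] // ij; have ql : Some q != Some l by rewrite eq_sym.
- have [x [xa xb fx]] := nonflip.
  have [g hg] : exists g, sec [:: Some l; Some q] g = [:: Some x; Some a].
    apply: eq_pattern_path => //; rewrite /reduced /= ?andbT //.
    case=> [|[y|] [|//]] //=; first by move=> *; apply: full_last_nil.
      by move=> *; apply: full_last_letter.
    by move=> *; apply/full_last_None/full_last_nil.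
  by apply: (@chi_path _ _ _ g); rewrite hg; apply: nonflip_pair_loop.
- have [s Ls hs] := @chi_restrict true false [:: Some l] q
      (@full_last_letter l) ql (@odd_loops_letter l true false isT).
  by exists s.
have [s Ls hs] := @odd_loops_letter l true false isT.
apply: (@chi_of_sum _ _ [:: Some l] q s) => //; first exact: full_last_letter.
rewrite (chi_sum_but_last _ [::]) /chi /= flips_along_nil addbF.
by move: hs; rewrite /chi addbF.
Qed.

(** The first letter has to be a state: on the one-letter word [None] the length
and the flip count of a loop coincide. *)
Lemma odd_loops_of_full_last w : reduced w -> head None w != None ->
  (forall v, reduced v -> size v < size w -> full_last v) -> odd_loops w.
Proof.
have [k] := ubnP (size w); elim: k w => // k IH w.
case/lastP: w => [|w x] //; rewrite size_rcons ltnS => hk.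
rewrite reduced_rcons => /andP[rw hx] hd HS.
have Sw : full_last w by apply: HS.
case/lastP: w => [|w y] in hk rw hx hd HS Sw *.
  by case: x hd {hx} => // q _; apply: odd_loops_letter.
have {}hd : head None (rcons w y) != None by case: (w) hd.
have Iw : odd_loops (rcons w y).
  by apply: IH => // v rv sv; apply: HS => //; apply: ltnW.
case: x hx => [q|] hx; last exact: odd_loops_step_None.
case: y => [l|] in hx hd Iw Sw rw hk HS *;
  last exact: odd_loops_step_after_None.
rewrite /nilp size_rcons last_rcons /= in hx.
case/lastP: w => [|w z] in hd Iw Sw rw hk HS *.
  by apply: odd_loops_pair; apply: contra hx => /eqP->.
apply: odd_loops_step_after_Some => // [|i]; first by rewrite eq_sym.
move: rw; rewrite reduced_rcons => /andP[rw hz].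
apply: chi_restrict.
- by apply: HS => //; rewrite !size_rcons.
- by move: hz; rewrite /nilp size_rcons /= eq_sym.
apply: IH => //.
- by rewrite size_rcons in hk; apply: leq_trans hk.
- by case: (w) hd.
  move=> v rv sv; apply: HS => //; apply: (leq_trans sv).
  by rewrite !size_rcons; do 2!apply: leqW.
exact: orbT.
Qed.

(** A leading letter [None] reverses the input of the rest and flips at every bit:
a loop of the rest with different parities of length and flip count is needed. *)
Lemma odd_flips_loop w : reduced w -> 0 < size w ->
  (forall v, reduced v -> size v < size w -> full_last v) ->
  exists2 s, loop w s & flips_along w s.
Proof.
case: w => [|[q|] w] // rw _ HS.
  have [s Ls hs] := @odd_loops_of_full_last _ rw isT HS false true isT.
  by exists s.
case: w => [|[q|] w] // in rw HS *; first by exists [:: false].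
have I : odd_loops (Some q :: w).
  by apply: odd_loops_of_full_last => // v rv sv; apply: HS => //; apply: ltnW.
have [s Ls hs] := I true true isT.
exists (outs [:: None] s).
  by rewrite /loop sec_cons outsK Ls.
by rewrite -[None :: _]cat1s flips_along_wcat outsK flips_along_None size_outs.
Qed.

Lemma full_last_reduced w : reduced w -> full_last w.
Proof.
have [k] := ubnP (size w).
elim: k w => // k IH [|x w] hk rw; first exact: full_last_nil.
have rw' : reduced w by move: rw; rewrite /reduced /= => /path_sorted.
case: x hk rw => [q|] hk rw; last by apply/full_last_None/IH.
have [w0|w0] := posnP (size w).
  by move/size0nil: w0 => ->; apply: full_last_letter.
have HS v : reduced v -> size v <= size w -> full_last v.
  by move=> rv sv; apply: IH => //; apply: leq_ltn_trans sv _.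
apply: full_last_cons => //; apply: odd_flips_loop => // v rv sv.
by apply: HS => //; apply: ltnW.
Qed.

Lemma reduced_nontrivial w : reduced w -> 0 < size w ->
  exists s, outs w s != s.
Proof.
move=> rw w0; have [|s Ls hs] := odd_flips_loop rw w0.
  by move=> v rv _; apply: full_last_reduced.
exists s; apply/eqP => e; have := odd_path_perm_outs w s; rewrite e hs addbT.
by case: (odd_perm _).
Qed.

Lemma freely_generate_letters (J : eqType) (emb : J -> option Q)
    (g : J -> bijGroup (seq bool)) :
  injective emb -> (forall j, g j =1 outs [:: emb j]) -> freely_generate_C2s g.
Proof.
move=> emb_inj gE; apply: freely_generate_of_reduced => [j|w rw w0].
  by apply: sym_inj => s; rewrite /= !gE outsK.
have ev s : (weval g w : bijGroup _) s = outs (rev (map emb w)) s.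
  elim: w {rw w0} => [|j w IH]; first by rewrite outs_nil.
  by rewrite /= gE IH rev_cons -cats1 outs_wcat.
have [||s hs] := @reduced_nontrivial (rev (map emb w)).
- rewrite reduced_rev /reduced sorted_map; apply: sub_sorted rw => i j /=.
  by rewrite (inj_eq emb_inj).
- by rewrite size_rev size_map.
by apply: contra hs => /eqP e; rewrite -ev e.
Qed.
End Dual.

(** * The automata of the family *)
Section Family.
Local Open Scope group_scope.

Lemma perm_boolE (p : {perm bool}) x : p x = x (+) (p != 1).
Proof.
have [->|pn1] := eqVneq p 1; first by rewrite perm1 addbF.
have pf : p false.
  apply: contraNT pn1 => /negbTE pf; apply/eqP/permP => y; rewrite perm1.
  case: y => //; apply/negPn/negP => /negbTE pt.
  by have := @perm_inj _ p true false; rewrite pt pf => /(_ erefl).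
case: x => //=; apply/negbTE/negP => pt.
by have := @perm_inj _ p true false; rewrite pt pf => /(_ erefl).
Qed.

Lemma swap01E x : swap01 x = ~~ x.
Proof. by case: x; rewrite /swap01 ?tpermL ?tpermR. Qed.

Variables (n : nat) (M : mealy (state n.+1) bool) (s : 'I_n.+2 -> {perm bool}).
Hypothesis n_odd : odd n.+1.
Hypothesis s_odd : odd #|[pred i | s i != 1]|.
Hypothesis Ma : wreath_eq M st_a swap01 st_c st_b.
Hypothesis Mb : wreath_eq M st_b swap01 st_b st_c.
Hypothesis Mc : forall i : 'I_n.+1, i = 0%N :> nat ->
  wreath_eq M st_c (s ord0) (st_d i) (st_d i).
Hypothesis Md : forall i j : 'I_n.+1, j = i.+1 :> nat ->
  wreath_eq M (st_d i) (s (lift ord0 i)) (st_d j) (st_d j).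
Hypothesis Mlast : forall i : 'I_n.+1, i.+1 = n.+1 ->
  wreath_eq M (st_d i) (s (lift ord0 i)) st_a st_a.

(** The relabelling composes every output permutation with the exchange of 0 and 1,
hence a state of the relabelled automaton flips if and only if its permutation
in the original automaton is trivial. *)
Definition flip_state (q : state n.+1) : bool :=
  match q with
  | st_a | st_b => false
  | st_c => s ord0 == 1
  | st_d i => s (lift ord0 i) == 1
  end.

Lemma ord_last_or_succ (i : 'I_n.+1) :
  i = n :> nat \/ exists j : 'I_n.+1, j = i.+1 :> nat.
Proof.
have := ltn_ord i; rewrite ltnS leq_eqVlt => /orP[/eqP|h]; first by left.
by right; exists (Ordinal (h : i.+1 < n.+1)).
Qed.

Lemma out_relabelE q x : out (relabel swap01 M) q x = x (+) flip_state q.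
Proof.
have E (t : {perm bool}) y : swap01 (t y) = y (+) (t == 1).
  by rewrite swap01E perm_boolE -addbN negbK.
have swap_neq1 : (swap01 == 1) = false.
  by apply/eqP => /permP/(_ true); rewrite swap01E perm1.
case: q => [|||i] /=.
- by have [-> _ _] := Ma; rewrite E swap_neq1.
- by have [-> _ _] := Mb; rewrite E swap_neq1.
- by have [-> _ _] := @Mc ord0 erefl; rewrite E.
have [hi|[j hj]] := ord_last_or_succ i.
  by have [-> _ _] := @Mlast i (congr1 S hi); rewrite E.
by have [-> _ _] := Md hj; rewrite E.
Qed.

(** The inverse of the transition map at the input 0. *)
Definition pred_state (q : state n.+1) : state n.+1 :=
  match q with
  | st_a => st_d ord_max
  | st_b => st_b
  | st_c => st_a
  | st_d i => if i : nat is k.+1 then st_d (inord k) else st_c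
  end.

Lemma pred_stateK : cancel pred_state (trans M ^~ false).
Proof.
case=> [|||i] /=.
- by have [_ -> _] := @Mlast ord_max erefl.
- by have [_ -> _] := Mb.
- by have [_ -> _] := Ma.
case: i => -[|k] hk /=; first by have [_ -> _] := @Mc (Ordinal hk) erefl.
have [|_ -> _ //] := @Md (inord k) (Ordinal hk).
by rewrite inordK // ltnW.
Qed.

Lemma trans0_inj : injective (trans M ^~ false).
Proof. exact: can_inj (canF_sym pred_stateK). Qed.

Definition state_perm (t : bool) : {perm state n.+1} :=
  if t then tperm st_a st_b * perm trans0_inj else perm trans0_inj.

Arguments state_perm : simpl never.

Lemma transE q t : trans M q t = state_perm t q.
Proof.
case: t; rewrite /state_perm ?permM permE //.
case: q => [|||i].
- by rewrite tpermL; have [_ _ ->] := Ma; have [_ -> _] := Mb.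
- by rewrite tpermR; have [_ -> _] := Ma; have [_ _ ->] := Mb.
- by rewrite tpermD //; have [_ -> ->] := @Mc ord0 erefl.
rewrite tpermD //; have [hi|[j hj]] := ord_last_or_succ i.
  by have [_ -> ->] := @Mlast i (congr1 S hi).
by have [_ -> ->] := Md hj.
Qed.

Lemma state_perm_orbit q :
  q != st_b -> exists i, q = iter i (state_perm false) st_a.
Proof.
have c1 : state_perm false st_a = st_c by rewrite -transE; have [_ -> _] := Ma.
case: q => [|||i] // _; [by exists 0%N|by exists 1%N; rewrite /= c1|].
case: i => k hk; exists k.+2.
elim: k hk => [|k IH] hk.
  by rewrite /= c1 -transE; have [_ -> _] := @Mc (Ordinal hk) erefl.
rewrite iterS -(IH (ltnW hk)) -transE.
by have [_ -> _] := @Md (Ordinal (ltnW hk)) (Ordinal hk) erefl.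
Qed.

Definition level_state (i : 'I_n.+2) : state n.+1 :=
  if unlift ord0 i is Some j then st_d j else st_c.

Lemma flip_level i : flip_state (level_state i) = (s i == 1).
Proof. by rewrite /level_state; case: unliftP => [j ->|->]. Qed.

Lemma level_state_inj : injective level_state.
Proof.
move=> i j; rewrite /level_state.
by case: unliftP => [i' ->|->]; case: unliftP => [j' ->|->] // [->].
Qed.

(** The [n.+2] states other than [a] and [b] are even in number, and an odd number
of them have a nontrivial permutation in the original automaton. *)
Lemma flip_state_odd : odd #|flip_state|.
Proof.
have -> : #|flip_state| = #|[seq level_state i | i in [pred i | s i == 1]]|.
  apply: eq_card => q; apply/idP/fintype.imageP => [|[i si ->]]; last first.
    by rewrite -topredE /= flip_level.
  rewrite -topredE /=; case: q => [|||i] //= h.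
    exists ord0; first by rewrite inE.
    by rewrite /level_state unlift_none.
  by exists (lift ord0 i); rewrite ?inE // /level_state liftK.
rewrite fintype.card_image; last exact: level_state_inj.
have := cardC [pred i | s i == 1]; rewrite card_ord => /(congr1 odd).
rewrite oddD oddS n_odd.
have -> : #|[predC [pred i | s i == 1]]| = #|[pred i | s i != 1]|.
  exact: eq_card.
by rewrite s_odd addbT => /negbFE.
Qed.

Lemma exists_nonflip_state :
  exists q, [/\ q != st_a, q != st_b & ~~ flip_state q].
Proof.
have /card_gt0P[i hi] : 0 < #|[pred i | s i != 1]| by case: #|_| s_odd.
exists (level_state i); rewrite flip_level; split=> //;
  by rewrite /level_state; case: unlift.
Qed.

Lemma act_relabelE q :
  Defs.act (relabel swap01 M) q =1 outs state_perm flip_state [:: Some q].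
Proof.
move=> w; elim: w q => //= x w IH q.
rewrite -[swap01 _]/(out (relabel swap01 M) q x).
by rewrite out_relabelE IH transE addbF.
Qed.

Lemma star_swap01E : star_sym swap01 =1 outs state_perm flip_state [:: None].
Proof. by move=> w; rewrite outs_None; apply: eq_map; apply: swap01E. Qed.

Lemma family_generate (J : eqType) (emb : J -> option (state n.+1))
    (g : J -> bijGroup (seq bool)) :
  injective emb ->
  (forall j, g j =1 if emb j is Some q then Defs.act (relabel swap01 M) q
                    else star_sym swap01) ->
  freely_generate_C2s g.
Proof.
move=> emb_inj gE.
have sb : state_perm false st_b = st_b by rewrite -transE; have [_ -> _] := Mb.
apply: (@freely_generate_letters _ state_perm flip_state st_a st_b _ _ _ _
  sb state_perm_orbit _ _ flip_state_odd exists_nonflip_state J emb g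
  emb_inj) => //.
- by rewrite card_state addn3.
- by rewrite card_state oddD n_odd.
move=> j w; rewrite gE; case: (emb j) => [q|]; first exact: act_relabelE.
exact: star_swap01E.
Qed.
End Family.

Lemma family_F_generate n (M : mealy (state n) bool) (J : eqType)
    (emb : J -> option (state n)) (g : J -> bijGroup (seq bool)) :
  family_F M -> injective emb ->
  (forall j, g j =1 if emb j is Some q then Defs.act (relabel swap01 M) q
                    else star_sym swap01) ->
  freely_generate_C2s g.
Proof.
case: n M emb => [|n] M emb [] // n_odd [s [s_odd Ma Mb Mc [Md Mlast]]].
exact: (family_generate n_odd s_odd Ma Mb Mc Md Mlast).
Qed.

Theorem theorem4p11 :
  (forall (n : nat) (M : mealy (state n) bool) (hM : family_F M),
    let invM := family_F_invertible hM in
    let inv01M := relabel_invertible (s := swap01) invM in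
    let g (o : option (state n)) : bijGroup (seq bool) :=
      if o is Some q then state_sym inv01M q else star_sym swap01 in
    [/\ forall q : state n,
          state_sym inv01M q = (star_sym swap01 * state_sym invM q)%g,
        #|{: option (state n)}| = (n + 4)%N
      & freely_generate_C2s g]) /\
  (forall (n : nat) (M' : mealy (state n) bool) (hM' : family_F' M'),
    freely_generate_C2s (state_sym (family_F'_invertible hM'))).
Proof.
split=> [n M hM invM inv01M g|n M' hM'].
  split.
  - move=> q; apply: sym_inj => w /=.
    by elim: w q => //= x w IH q; rewrite IH.
  - by rewrite card_option card_state !addnS.
  by apply: (@family_F_generate n M _ id g) => // -[q|].
have [M hM M'E] := hM'.
apply: (@family_F_generate n M _ Some) => [|q q' []|q w] //.
by rewrite /= -M'E.
Qed.
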